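(* Let $B=\mathcal{O}_q(G/L_S)$ be an irreducible quantum flag manifold and let $k\in\mathbb{Z}_{>0}$. Let $\{f_i\}_{i=1}^M,\{f_i'\}_{i=1}^M\subseteq V_k$ and $\{v_i\}_{i=1}^M,\{v_i'\}_{i=1}^M\subseteq{}^\vee V_k$ be finite families with $$\sum_{i=1}^Mf_iv_i=1,\qquad\sum_{i=1}^Mv_i'f_i'=1.$$ 1. The bimodule map $\sigma_k\colon\mathcal{E}_k\otimes_B\Omega^{(0,1)}_q(G/L_S)\to\Omega^{(0,1)}_q(G/L_S)\otimes_B\mathcal{E}_k$ associated to the connection $\overline{\partial}_{\mathcal{E}_k}$ satisfies, for all $e\in\mathcal{E}_k$, $b\in B$, $$\sigma_k(e\otimes\overline{\partial}b)=\sum_{i=1}^M\overline{\partial}(ebv_i')\otimes f_i'-\sum_{i=1}^M\overline{\partial}(ev_i')\otimes f_i'b,$$ and its inverse satisfies $$\sigma_k^{-1}(\overline{\partial}b\otimes e)=\sum_{i=1}^Mf_i\otimes\overline{\partial}(v_ibe)-\sum_{i=1}^Mbf_i\otimes\overline{\partial}(v_ie).$$ 2. The bimodule map $\sigma_{-k}\colon\mathcal{E}_{-k}\otimes_B\Omega^{(0,1)}_q(G/L_S)\to\Omega^{(0,1)}_q(G/L_S)\otimes_B\mathcal{E}_{-k}$ associated to the connection $\overline{\partial}_{\mathcal{E}_{-k}}$ satisfies, for all $e\in\mathcal{E}_{-k}$, $b\in B$, $$\sigma_{-k}(e\otimes\overline{\partial}b)=\sum_{i=1}^M\overline{\partial}(ebf_i)\otimes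 v_i-\sum_{i=1}^M\overline{\partial}(ef_i)\otimes v_ib,$$ and its inverse satisfies $$\sigma_{-k}^{-1}(\overline{\partial}b\otimes e)=\sum_{i=1}^Mv_i'\otimes\overline{\partial}(f_i'be)-\sum_{i=1}^Mbv_i'\otimes\overline{\partial}(f_i'e).$$
   Context: **Connections.** A first-order differential calculus (fodc) over an algebra $B$ is a pair $(\Omega^1(B),\mathrm{d})$ with $\Omega^1(B)$ a $B$-bimodule and $\mathrm{d}\colon B\to\Omega^1(B)$ a derivation such that $\Omega^1(B)$ is generated as a left $B$-module by $\mathrm{d}B$. The restriction of a fodc over $P$ to a subalgebra $B$ is the sub-calculus over $B$ generated by $\mathrm{d}b$, $b\in B$. A left connection on a left $B$-module $\mathcal{F}$ is a linear map $\nabla\colon\mathcal{F}\to\Omega^1(B)\otimes_B\mathcal{F}$ with $\nabla(bf)=\mathrm{d}b\otimes f+b\nabla f$. If $\mathcal{F}$ is a $B$-bimodule, $\nabla$ is a bimodule connection if there is a $B$-bimodule map $\sigma\colon\mathcal{F}\otimes_B\Omega^1(B)\to\Omega^1(B)\otimes_B\mathcal{F}$ with $\sigma(f\otimes\mathrm{d}b)=\nabla(fb)-\nabla(f)b$; $\sigma$ is the associated bimodule map. **Quantum groups.** $\mathfrak{g}$ is a finite-dimensional complex simple Lie algebra with simple roots $\alpha_1,\dots,\alpha_l$, Cartan matrix $(a_{ij})$, fundamental weights $\varpi_1,\dots,\varpi_l$, form normalised so that short simple roots satisfy $(\alpha_i,\alpha_i)=2$; $q\in\mathbb{R}\setminus\{-1,0,1\}$,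 $q_i=q^{(\alpha_i,\alpha_i)/2}$. $U_q(\mathfrak{g})$ is the Drinfeld--Jimbo Hopf algebra with generators $E_i,F_i,K_i^{\pm1}$, relations $K_iE_j=q_i^{a_{ij}}E_jK_i$, $K_iF_j=q_i^{-a_{ij}}F_jK_i$, $K_iK_j=K_jK_i$, $E_iF_j-F_jE_i=\delta_{ij}(K_i-K_i^{-1})/(q_i-q_i^{-1})$ and the quantum Serre relations, coproduct $\Delta K_i=K_i\otimes K_i$, $\Delta E_i=E_i\otimes K_i+1\otimes E_i$, $\Delta F_i=F_i\otimes1+K_i^{-1}\otimes F_i$, and $\varepsilon(E_i)=\varepsilon(F_i)=0$, $\varepsilon(K_i)=1$. $V_\lambda$ is the irreducible type-1 module of dominant highest weight $\lambda$. $\mathcal{O}_q(G)\subseteq U_q(\mathfrak{g})^\circ$ is the Hopf subalgebra generated by the coordinate functions $c^V_{f,v}(X)=f(Xv)$, $V$ a type-1 module, $v\in V$, $f\in V^*$. $U_q(\mathfrak{g})$ acts on it by $X\triangleright c^V_{f,v}=c^V_{f,Xv}$. **Irreducible quantum flag manifolds.** Let $\alpha_x$ be a simple root with coefficient $1$ in the highest root of $\mathfrak{g}$ and $S=\{\alpha_1,\dots,\alpha_l\}\setminus\{\alpha_x\}$. Let $U_q(\mathfrak{l}_S)\subseteq U_q(\mathfrak{g})$ be generated by all $K_i^{\pm1}$ and by $E_s,F_s$, $s\in S$, and $U_q(\mathfrak{l}_S^{\mathrm{s}})$ by $K_s^{\pm1},E_s,F_s$, $s\in S$. The irreducible quantum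 flag manifold $B=\mathcal{O}_q(G/L_S)$ and the quantum Poisson homogeneous space $\mathcal{O}_q(G/L_S^{\mathrm{s}})$ are the subalgebras of $\mathcal{O}_q(G)$ of elements $a$ with $X\triangleright a=\varepsilon(X)a$ for all $X\in U_q(\mathfrak{l}_S)$, resp. $X\in U_q(\mathfrak{l}^{\mathrm{s}}_S)$. Both are left $\mathcal{O}_q(G)$-comodule algebras via $\Delta$. Let $\{u_i\}_{i=1}^N$ be a weight basis of $V_{\varpi_x}$ with $u_N$ a highest weight vector and $\{u^i\}$ the dual basis of the dual module $V_{-w_0(\varpi_x)}$. Then $\mathcal{O}_q(G/L_S^{\mathrm{s}})$ is generated by $z_i=c^{V_{\varpi_x}}_{u^i,u_N}$ and $\overline{z}_j=c^{V_{-w_0(\varpi_x)}}_{u_j,u^N}$, and it has a strong $\mathbb{Z}$-algebra grading $\mathcal{O}_q(G/L_S^{\mathrm{s}})=\bigoplus_{k\in\mathbb{Z}}\mathcal{E}_k$ determined by $\deg z_i=1$, $\deg\overline{z}_j=-1$ (equivalently a right $\mathcal{O}(U_1)$-comodule algebra structure, $\mathcal{O}(U_1)$ the Laurent polynomial Hopf algebra). One has $\mathcal{E}_0=B$; each $\mathcal{E}_k$ is a $B$-bimodule and left $\mathcal{O}_q(G)$-subcomodule, called a relative line module. For $k\in\mathbb{Z}_{>0}$, $V_k\subseteq\mathcal{E}_k$ and ${}^\vee V_k\subseteq\mathcal{E}_{-k}$ are the irreducible left $\mathcal{O}_q(G)$-subcomodules (equivalently, irreducible $U_q(\mathfrak{g})$-modules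 for the action induced by the left coaction) generated by $z_N^k$ and $\overline{z}_N^k$ respectively; they are dual to each other, and families as in the statement exist since both $V_k\otimes{}^\vee V_k$ and ${}^\vee V_k\otimes V_k$ contain the trivial module. **Heckenberger--Kolb calculi.** A fodc over $B$ (or over $\mathcal{O}_q(G/L^{\mathrm{s}}_S)$) is left $\mathcal{O}_q(G)$-covariant if $b\,\mathrm{d}b'\mapsto b_{(1)}b'_{(1)}\otimes b_{(2)}\mathrm{d}b'_{(2)}$ is a well-defined left coaction on it; a covariant connection is one that is a left comodule map. Up to isomorphism there are exactly two finite-dimensional irreducible left $\mathcal{O}_q(G)$-covariant fodc over $B$ (irreducible: nonzero with no proper nonzero covariant sub-bimodule; finite-dimensional: $\Omega^1/B^+\Omega^1$ finite-dimensional, $B^+=B\cap\ker\varepsilon$), and $(\Omega^{(0,1)}_q(G/L_S),\overline{\partial})$ denotes the one that is the restriction of a left $\mathcal{O}_q(G)$-covariant, right $\mathcal{O}(U_1)$-covariant fodc over $\mathcal{O}_q(G/L_S^{\mathrm{s}})$ with $\overline{\partial}z_i=0$ for all $i$. It is known that each $\mathcal{E}_k$, $k\in\mathbb{Z}$, admits a unique left $\mathcal{O}_q(G)$-covariant connection $\overline{\partial}_{\mathcal{E}_k}\colon\mathcal{E}_k\to\Omega^{(0,1)}_q(G/L_S)\otimes_B\mathcal{E}_k$; it is a bimodule connection with invertible associated bimodule map $\sigma_k$. *)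

(* Defs.v *)
From HB Require Import structures.
From mathcomp Require Import all_boot all_order all_algebra.
From mathcomp Require Import generic_quotient.
From mathcomp Require Import boolp reals complex ring zify.
From mathcomp Require classical_sets.
Set Implicit Arguments. Unset Strict Implicit. Unset Printing Implicit Defensive.
Import Order.TTheory GRing.Theory Num.Theory.
Local Open Scope ring_scope.
Local Open Scope quotient_scope.


Section Tensor.
Variables (F : fieldType) (M N : lmodType F) (S : Type).
Variables (ra : M -> S -> M) (la : S -> N -> N).

Definition balanced (T : lmodType F) (beta : M -> N -> T) : Prop :=
  [/\ forall n, linear (beta^~ n), forall m, linear (beta m)
    & forall m s n, beta (ra m s) n = beta m (la s n)].

Definition fsum (T : lmodType F) (beta : M -> N -> T) (s : seq (M * N)) : T :=
  \sum_(p <- s) beta p.1 p.2.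

(* Two formal sums are the same tensor when no balanced map separates them:
   this is the congruence generated by bilinearity and m.s (x) n = m (x) s.n,
   since the tensor product is itself the target of a balanced map. *)
Definition tens_eq (s t : seq (M * N)) : Prop :=
  forall (T : lmodType F) (beta : M -> N -> T),
    balanced beta -> fsum beta s = fsum beta t.

Definition tens_eqb (s t : seq (M * N)) : bool := `[< tens_eq s t >].

Lemma tens_eqb_refl : reflexive tens_eqb.
Proof. by move=> s; apply/asboolP. Qed.
Lemma tens_eqb_sym : symmetric tens_eqb.
Proof. by move=> s t; apply/asboolP/asboolP => h T beta hb; rewrite h. Qed.
Lemma tens_eqb_trans : transitive tens_eqb.
Proof.
move=> t s u /asboolP h1 /asboolP h2; apply/asboolP => T beta hb.
by rewrite h1 // h2.
Qed.

Canonical tens_equiv :=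
  EquivRel tens_eqb tens_eqb_refl tens_eqb_sym tens_eqb_trans.

Definition tens : Type := {eq_quot tens_equiv}.
HB.instance Definition _ := Choice.on tens.
HB.instance Definition _ := EqQuotient.on tens.

Definition tensor (m : M) (n : N) : tens := \pi_tens [:: (m, n)].

(* Sum of a family over a formal sum representing a tensor; independent of the
   representative as soon as beta is balanced. *)
Definition tlift (T : lmodType F) (beta : M -> N -> T) (t : tens) : T :=
  fsum beta (repr t).

Lemma tens_piP s t : reflect (tens_eq s t) (\pi_tens s == \pi_tens t).
Proof. by rewrite eqmodE; apply: asboolP. Qed.

Lemma tlift_pi (T : lmodType F) (beta : M -> N -> T) s :
  balanced beta -> tlift beta (\pi_tens s) = fsum beta s.
Proof.
move=> hb; rewrite /tlift.
by have /eqP/tens_piP -> := reprK (\pi_tens s).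
Qed.

Lemma balanced0l (T : lmodType F) (beta : M -> N -> T) n :
  balanced beta -> beta 0 n = 0.
Proof. by case=> h _ _; have := h n (-1) 0 0; rewrite scaler0 addr0 scaleN1r addNr. Qed.
Lemma balancedZl (T : lmodType F) (beta : M -> N -> T) c m n :
  balanced beta -> beta (c *: m) n = c *: beta m n.
Proof.
by move=> hb; case: (hb) => h _ _; have := h n c m 0; rewrite !addr0 balanced0l // addr0.
Qed.
Lemma balancedDl (T : lmodType F) (beta : M -> N -> T) m m' n :
  balanced beta -> beta (m + m') n = beta m n + beta m' n.
Proof. by case=> h _ _; have := h n 1 m m'; rewrite !scale1r. Qed.
Lemma balanced0r (T : lmodType F) (beta : M -> N -> T) m :
  balanced beta -> beta m 0 = 0.
Proof. by case=> _ h _; have := h m (-1) 0 0; rewrite scaler0 addr0 scaleN1r addNr. Qed.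
Lemma balancedZr (T : lmodType F) (beta : M -> N -> T) c m n :
  balanced beta -> beta m (c *: n) = c *: beta m n.
Proof.
by move=> hb; case: (hb) => _ h _; have := h m c n 0; rewrite !addr0 balanced0r // addr0.
Qed.
Lemma balancedDr (T : lmodType F) (beta : M -> N -> T) m n n' :
  balanced beta -> beta m (n + n') = beta m n + beta m n'.
Proof. by case=> _ h _; have := h m 1 n n'; rewrite !scale1r. Qed.

Definition tens_zero : tens := \pi_tens [::].
Definition tens_add (t u : tens) : tens := \pi_tens (repr t ++ repr u).
Definition tens_scale (c : F) (t : tens) : tens :=
  \pi_tens [seq (c *: p.1, p.2) | p <- repr t].
Definition tens_opp (t : tens) : tens := tens_scale (-1) t.

Lemma fsum_cat (T : lmodType F) (beta : M -> N -> T) s t :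
  fsum beta (s ++ t) = fsum beta s + fsum beta t.
Proof. exact: big_cat. Qed.
Lemma fsum_scale (T : lmodType F) (beta : M -> N -> T) c s :
  balanced beta ->
  fsum beta [seq (c *: p.1, p.2) | p <- s] = c *: fsum beta s.
Proof.
move=> hb; rewrite /fsum big_map scaler_sumr; apply: eq_bigr => p _ /=.
exact: balancedZl.
Qed.

Lemma tens_extP (t u : tens) :
  (forall (T : lmodType F) (beta : M -> N -> T), balanced beta ->
     tlift beta t = tlift beta u) -> t = u.
Proof. by move=> h; rewrite -[t]reprK -[u]reprK; apply/eqP/tens_piP. Qed.

Lemma tens_addE (T : lmodType F) (beta : M -> N -> T) t u : balanced beta ->
  tlift beta (tens_add t u) = tlift beta t + tlift beta u.
Proof. by move=> hb; rewrite tlift_pi // fsum_cat. Qed.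
Lemma tens_scaleE (T : lmodType F) (beta : M -> N -> T) c t : balanced beta ->
  tlift beta (tens_scale c t) = c *: tlift beta t.
Proof. by move=> hb; rewrite tlift_pi // fsum_scale. Qed.
Lemma tens_zeroE (T : lmodType F) (beta : M -> N -> T) : balanced beta ->
  tlift beta tens_zero = 0.
Proof. by move=> hb; rewrite tlift_pi // /fsum big_nil. Qed.

Lemma tens_addA : associative tens_add.
Proof. by move=> t u v; apply: tens_extP => T beta hb; rewrite !tens_addE // addrA. Qed.
Lemma tens_addC : commutative tens_add.
Proof. by move=> t u; apply: tens_extP => T beta hb; rewrite !tens_addE // addrC. Qed.
Lemma tens_add0 : left_id tens_zero tens_add.
Proof.
by move=> t; apply: tens_extP => T beta hb; rewrite tens_addE // tens_zeroE // add0r.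
Qed.
Lemma tens_addN : left_inverse tens_zero tens_opp tens_add.
Proof.
move=> t; apply: tens_extP => T beta hb.
by rewrite tens_addE // tens_scaleE // tens_zeroE // scaleN1r addNr.
Qed.
HB.instance Definition _ :=
  GRing.isZmodule.Build tens tens_addA tens_addC tens_add0 tens_addN.

Lemma tens_scaleA a b t : tens_scale a (tens_scale b t) = tens_scale (a * b) t.
Proof. by apply: tens_extP => T beta hb; rewrite !tens_scaleE // scalerA. Qed.
Lemma tens_scale1 : left_id 1 tens_scale.
Proof. by move=> t; apply: tens_extP => T beta hb; rewrite tens_scaleE // scale1r. Qed.
Lemma tens_scaleDr : right_distributive tens_scale +%R.
Proof.
move=> c t u; apply: tens_extP => T beta hb.
by rewrite tens_addE // !tens_scaleE // tens_addE // scalerDr.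
Qed.
Lemma tens_scaleDl t : {morph tens_scale^~ t : a b / a + b}.
Proof.
move=> a b; apply: tens_extP => T beta hb.
by rewrite tens_addE // !tens_scaleE // scalerDl.
Qed.
HB.instance Definition _ := GRing.Zmodule_isLmodule.Build F tens
  tens_scaleA tens_scale1 tens_scaleDr tens_scaleDl.

Lemma tlift_linear (T : lmodType F) (beta : M -> N -> T) :
  balanced beta -> linear (tlift beta).
Proof. by move=> hb c t u; rewrite tens_addE // tens_scaleE. Qed.

Lemma tlift_tensor (T : lmodType F) (beta : M -> N -> T) m n :
  balanced beta -> tlift beta (tensor m n) = beta m n.
Proof. by move=> hb; rewrite tlift_pi // /fsum big_seq1. Qed.

Lemma tensor_balanced : balanced tensor.
Proof.
split=> [n c m m'|m c n n'|m s n]; apply: tens_extP => T beta hb;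
  rewrite ?tens_addE ?tens_scaleE ?tlift_tensor //.
- by rewrite balancedDl ?balancedZl.
- by rewrite balancedDr ?balancedZr.
- by case: hb.
Qed.

Lemma tens_reprE (t : tens) : t = \sum_(p <- repr t) tensor p.1 p.2.
Proof.
apply: tens_extP => T beta hb.
pose f : {linear tens -> T} := HB.pack (tlift beta)
   (GRing.isLinear.Build _ _ _ _ _ (tlift_linear hb)).
rewrite -[RHS]/(f _) raddf_sum /=.
by under [RHS]eq_bigr => p _ do rewrite tlift_tensor //.
Qed.

Lemma tens_ind (P : tens -> Prop) :
  (forall m n, P (tensor m n)) -> P 0 -> (forall t u, P t -> P u -> P (t + u)) ->
  forall t, P t.
Proof.
by move=> h1 h0 hD t; rewrite (tens_reprE t); elim/big_ind: _.
Qed.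

End Tensor.

Definition scale_r (F : fieldType) (M : lmodType F) (m : M) (c : F) : M := c *: m.
Definition scale_l (F : fieldType) (M : lmodType F) (c : F) (m : M) : M := c *: m.
(* Tensor product over the ground field. *)
Notation ftens M N := (tens (@scale_r _ M) (@scale_l _ N)).
Notation ften m n := (tensor (@scale_r _ _) (@scale_l _ _) m n).


(* A finite-dimensional complex simple Lie algebra, given by its Cartan matrix:
   an indecomposable Cartan matrix of finite type (Killing-Cartan).
   cartan i j = 2 (alpha_i, alpha_j) / (alpha_i, alpha_i) and
   sdiag i = (alpha_i, alpha_i) / 2, which is 1 on short simple roots. *)
Record simple_type := SimpleType {
  rank : nat;
  cartan :> 'M[int]_rank;
  sdiag : 'I_rank -> nat;
  rank_gt0 : (0 < rank)%N;
  cartan_diag : forall i, cartan i i = 2;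
  cartan_offdiag : forall i j, i != j -> cartan i j <= 0;
  cartan_sym : forall i j, (sdiag i)%:Z * cartan i j = (sdiag j)%:Z * cartan j i;
  cartan_pos : forall v : 'rV[int]_rank, v != 0 ->
    0 < \sum_i \sum_j v 0 i * ((sdiag i)%:Z * cartan i j) * v 0 j;
  cartan_indec : forall I : {set 'I_rank}, I != set0 -> I != setT ->
    exists i j, [/\ i \in I, j \notin I & cartan i j != 0];
  sdiag_short : exists i, sdiag i = 1%N
}.

Lemma sdiag_gt0 (g : simple_type) i : (0 < sdiag (s := g) i)%N.
Proof.
have nz : delta_mx 0 i != 0 :> 'rV[int]_(rank g).
  by apply/eqP => /rowP /(_ i); rewrite !mxE !eqxx.
have := cartan_pos nz; rewrite lt0n; apply: contraTN => /eqP d0.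
rewrite (bigD1 i) //= (bigD1 i) //= big1 ?big1 ?addr0.
- by rewrite d0 mul0r mulr0 mul0r ltxx.
- move=> j ji; apply: big1 => k _; rewrite !mxE.
  by rewrite (negPf ji) /= !mul0r.
- by move=> j ji; rewrite !mxE (negPf ji) andbF mulr0.
Qed.

(* Symmetric Gaussian binomial [n choose k]_v, by the q-Pascal rule. *)
Fixpoint qbinom (F : fieldType) (v : F) (n k : nat) : F :=
  match n, k with
  | _, 0%N => 1
  | 0%N, _.+1 => 0
  | n'.+1, k'.+1 => v ^+ k'.+1 * qbinom v n' k'.+1 + v ^- (n' - k') * qbinom v n' k'
  end.

Lemma qbinom_small (F : fieldType) (v : F) n k : (n < k)%N -> qbinom v n k = 0.
Proof.
elim: n k => [|n ih] [|k] //= nk; rewrite ih ?ih ?mulr0 ?addr0 //.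
exact: ltnW.
Qed.

Lemma qbinom0 (F : fieldType) (v : F) n : qbinom v n 0 = 1.
Proof. by case: n. Qed.

Section Serre.
Variables (F : fieldType) (A : algType F).
Implicit Types (v : F) (x y : A).

Definition serre v m x y : A :=
  \sum_(k < m.+1) ((-1) ^+ k * qbinom v m k) *: (x ^+ (m - k) * y * x ^+ k).

(* The Serre expression factors as prod_s (L_x - v^(m-1-2s) R_x). *)
Definition dop x (w : A) (c : F) : A := x * w - c *: (w * x).

Lemma dopC x w c c' : dop x (dop x w c) c' = dop x (dop x w c') c.
Proof.
rewrite /dop !mulrBr !mulrBl !scalerBr -!scalerAl -!scalerAr !scalerA !mulrA.
rewrite [c * c']mulrC !opprB !addrA.
rewrite -!addrA; congr (_ + _); rewrite !addrA.
set a := c *: _; set b := c' *: _.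
by rewrite addrC [RHS]addrC !addrA [-a + _]addrC -!addrA; congr (_ + _); rewrite addrC.
Qed.

Lemma foldl_dop_rcons x w s c :
  foldl (dop x) (dop x w c) s = dop x (foldl (dop x) w s) c.
Proof. by elim: s w => //= c' s ih w; rewrite dopC ih. Qed.

Lemma foldl_dop_rev x w s : foldl (dop x) w (rev s) = foldl (dop x) w s.
Proof.
elim: s w => //= c s ih w.
by rewrite rev_cons -cats1 foldl_cat /= ih foldl_dop_rcons.
Qed.

Definition qroots v m (c : F) := [seq c * v ^+ m.-1 * v ^- (2 * s) | s <- iota 0 m].

Lemma serre_gen v m (c : F) x y : v != 0 ->
  \sum_(k < m.+1) (((-1) ^+ k * qbinom v m k) * c ^+ k) *: (x ^+ (m - k) * y * x ^+ k)
  = foldl (dop x) y (qroots v m c).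
Proof.
move=> v0; elim: m c => [|m ih] c.
  by rewrite big_ord1 /= !expr0 !mulr1 scale1r mul1r.
have -> : qroots v m.+1 c = rcons (qroots v m (c * v)) (c * v ^- m).
  rewrite /qroots -[in LHS]addn1 iotaD map_cat /= cats1 add0n; congr rcons.
    apply/eq_in_map => s; rewrite mem_iota add0n => /andP [_ sm].
    by case: m sm {ih} => //= m _; rewrite -[c * v * _]mulrA -exprS addn1.
  rewrite addn1 /= -mulrA; congr (_ * _).
  by rewrite mulSn mul1n exprD invfM mulrA mulfV ?mul1r ?expf_neq0.
rewrite foldl_rcons -ih /dop mulr_sumr mulr_suml scaler_sumr.
rewrite big_ord_recl [X in _ = X - _]big_ord_recl /= !subn0 qbinom0.
rewrite !expr0 !mulr1 !scale1r exprS -!mulrA -addrA; congr (_ + _).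
transitivity (\sum_(k < m.+1)
    (((-1) ^+ k.+1 * (v ^+ k.+1 * qbinom v m k.+1) * c ^+ k.+1) *:
       (x ^+ (m - k) * y * x ^+ k.+1)) +
  \sum_(k < m.+1) (((-1) ^+ k.+1 * (v ^- (m - k) * qbinom v m k) * c ^+ k.+1) *:
       (x ^+ (m - k) * y * x ^+ k.+1))).
  rewrite -big_split /=; apply: eq_bigr => k _.
  by rewrite /bump /= !add1n subSS add0n -scalerDl -mulrDl -mulrDr.
rewrite -sumrN; congr (_ + _).
  rewrite big_ord_recr /= qbinom_small // !mulr0 mul0r scale0r addr0.
  apply: eq_bigr => k _; rewrite /bump /= !add1n exprMn -scalerAr !mulrA -exprS subnSK //.
  by congr (_ *: _); ring.
apply: eq_bigr => k _.
rewrite -scalerAl !scalerA -!mulrA -exprSr -scaleNr; congr (_ *: _).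
have km : (k <= m)%N by rewrite -ltnS.
have -> : v ^- (m - k) = v ^- m * v ^+ k.
  have -> : v ^+ m = v ^+ (m - k) * v ^+ k by rewrite -exprD subnK.
  by rewrite invfM -mulrA mulVf ?mulr1 ?expf_neq0.
by rewrite exprMn !exprS; ring.
Qed.

Lemma serreE v m x y : v != 0 ->
  serre v m x y = foldl (dop x) y (qroots v m 1).
Proof.
move=> v0; rewrite -serre_gen //; apply: eq_bigr => k _.
by rewrite expr1n mulr1.
Qed.

Lemma serre_shift1 v m (a b c : A) : v != 0 ->
  a * b = v ^+ 2 *: (b * a) -> b * c = v ^+ m.-1 *: (c * b) ->
  serre v m (a + b) c = serre v m a c.
Proof.
move=> v0 ab bc; rewrite !serreE // /qroots.
suff H n s0 w : b * w = (v ^+ m.-1 * v ^- (2 * s0)) *: (w * b) ->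
    foldl (dop (a + b)) w [seq 1 * v ^+ m.-1 * v ^- (2 * s) | s <- iota s0 n]
  = foldl (dop a) w [seq 1 * v ^+ m.-1 * v ^- (2 * s) | s <- iota s0 n].
  by apply: H; rewrite muln0 expr0 invr1 mulr1.
elim: n s0 w => //= n ih s0 w bw.
have -> : dop (a + b) w (1 * v ^+ m.-1 / v ^+ (2 * s0)) =
          dop a w (1 * v ^+ m.-1 / v ^+ (2 * s0)).
  by rewrite /dop mulrDl mulrDr scalerDr bw mul1r opprD addrACA subrr addr0.
apply: ih; rewrite /dop mulrBr mulrBl.
have ba : b * a = v ^- 2 *: (a * b) by rewrite ab scalerA mulVf ?scale1r ?expf_neq0.
have vE : v ^- (2 * s0.+1) = v ^- 2 * v ^- (2 * s0).
  by rewrite mulnS exprD invfM.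
rewrite scalerBr !mulrA ba -scalerAl -!mulrA bw -scalerAr -!scalerAl !scalerA.
congr (_ - _); first by rewrite vE mulrCA !mulrA.
rewrite -scalerAr [b * (w * a)]mulrA bw -scalerAl -mulrA ba -scalerAr mulrA.
by rewrite !scalerA -!mulrA; congr (_ *: _); rewrite vE; ring.
Qed.

Lemma serre_shift2 v m (a b d : A) : v != 0 ->
  a * b = v ^+ 2 *: (b * a) -> d * a = v ^+ m.-1 *: (a * d) ->
  serre v m (a + b) d = serre v m b d.
Proof.
move=> v0 ab da; rewrite !serreE // -!(foldl_dop_rev _ _ (qroots _ _ _)).
pose mu s := v ^- m.-1 * v ^+ (2 * s).
have -> : rev (qroots v m 1) = [seq mu s | s <- iota 0 m].
  apply: (@eq_from_nth _ 0) => [|i].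
    by rewrite size_rev !size_map.
  rewrite size_rev size_map size_iota => im.
  rewrite nth_rev ?size_map ?size_iota // (nth_map 0%N) ?size_iota; last first.
    by rewrite ltn_subrL /= (leq_ltn_trans _ im).
  rewrite (nth_map 0%N) ?size_iota // !nth_iota //; last first.
    by rewrite ltn_subrL /= (leq_ltn_trans _ im).
  rewrite !add0n /mu mul1r.
  have {mu} -> : m.-1 = (i + (m - i.+1))%N by case: (m) im => // m' im' /=; rewrite subSS subnKC.
  rewrite !mul2n -!addnn !exprD !invfM.
  have := expf_neq0 i v0; have := expf_neq0 (m - i.+1) v0.
  by move: (v ^+ i) (v ^+ (m - i.+1)) => s t t0 s0; field; rewrite t0 s0.
suff H n s0 w : a * w = mu s0 *: (w * a) ->
    foldl (dop (a + b)) w [seq mu s | s <- iota s0 n]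
  = foldl (dop b) w [seq mu s | s <- iota s0 n].
  apply: H; rewrite /mu muln0 expr0 mulr1 da scalerA mulVf ?scale1r //.
  exact: expf_neq0.
elim: n s0 w => //= n ih s0 w aw.
have -> : dop (a + b) w (mu s0) = dop b w (mu s0).
  by rewrite /dop mulrDl mulrDr scalerDr aw opprD addrACA subrr add0r.
apply: ih; rewrite /dop mulrBr mulrBl.
have vE : mu s0.+1 = v ^+ 2 * mu s0.
  by rewrite /mu mulnS exprD; ring.
rewrite scalerBr !mulrA ab -scalerAl -!mulrA aw -scalerAr -!scalerAl !scalerA.
congr (_ - _); first by rewrite vE.
rewrite -scalerAr [a * (w * b)]mulrA aw -scalerAl -mulrA ab -scalerAr mulrA.
by rewrite !scalerA vE; congr (_ *: _); ring.
Qed.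

Lemma serreDr v m x y z : serre v m x (y + z) = serre v m x y + serre v m x z.
Proof.
rewrite /serre -big_split /=; apply: eq_bigr => k _.
by rewrite mulrDr mulrDl scalerDr.
Qed.

Lemma serre_add v m (a b c d : A) : v != 0 ->
  a * b = v ^+ 2 *: (b * a) -> b * c = v ^+ m.-1 *: (c * b) ->
  d * a = v ^+ m.-1 *: (a * d) ->
  serre v m (a + b) (c + d) = serre v m a c + serre v m b d.
Proof. by move=> v0 ab bc da; rewrite serreDr serre_shift1 // serre_shift2. Qed.

Lemma serre0 v m x : serre v m x 0 = 0.
Proof. by rewrite /serre big1 // => k _; rewrite mulr0 mul0r scaler0. Qed.
End Serre.


Lemma fbalanced (C : fieldType) (M N T : lmodType C) (beta : M -> N -> T) :
  (forall n, linear (beta^~ n)) -> (forall m, linear (beta m)) ->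
  balanced (@scale_r _ M) (@scale_l _ N) beta.
Proof.
move=> hl hr; split=> // m c n; rewrite /scale_r /scale_l.
have h0l : beta 0 n = 0.
  by have := hl n (-1) 0 0; rewrite scaler0 addr0 scaleN1r addNr.
have h0r : beta m 0 = 0.
  by have := hr m (-1) 0 0; rewrite scaler0 addr0 scaleN1r addNr.
have := hl n c m 0; have := hr m c n 0.
by rewrite !addr0 h0l h0r !addr0 => -> ->.
Qed.

Section TensorLemmas.
Variables (C : fieldType) (M N : lmodType C).
Lemma ftenDl (m m' : M) (n : N) : ften (m + m') n = ften m n + ften m' n.
Proof. exact: (balancedDl _ _ _ (tensor_balanced _ _)). Qed.
Lemma ftenDr (m : M) (n n' : N) : ften m (n + n') = ften m n + ften m n'.
Proof. exact: (balancedDr _ _ _ (tensor_balanced _ _)). Qed.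
Lemma ftenZl c (m : M) (n : N) : ften (c *: m) n = c *: ften m n.
Proof. exact: (balancedZl _ _ _ (tensor_balanced _ _)). Qed.
Lemma ftenZr c (m : M) (n : N) : ften m (c *: n) = c *: ften m n.
Proof. exact: (balancedZr _ _ _ (tensor_balanced _ _)). Qed.
Lemma ften0l (n : N) : ften (0 : M) n = 0.
Proof. exact: (balanced0l _ (tensor_balanced _ _)). Qed.
Lemma ften0r (m : M) : ften m (0 : N) = 0.
Proof. exact: (balanced0r _ (tensor_balanced _ _)). Qed.
End TensorLemmas.

Section TensorMul.
Variables (C : fieldType) (A B : algType C).

Definition tens_mul (t u : ftens A B) : ftens A B :=
  tlift (fun a b => tlift (fun a' b' => ften (a * a') (b * b')) u) t.

Let bal_inner (a : A) (b : B) :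
  balanced (@scale_r _ A) (@scale_l _ B) (fun a' b' => ften (a * a') (b * b')).
Proof.
apply: fbalanced => [n c x y|m c x y].
  by rewrite mulrDr ftenDl -scalerAr ftenZl.
by rewrite mulrDr ftenDr -scalerAr ftenZr.
Qed.

Lemma tlift_bilin (u : ftens A B) : balanced (@scale_r _ A) (@scale_l _ B)
  (fun a b => tlift (fun a' b' => ften (a * a') (b * b')) u).
Proof.
apply: fbalanced => [n c x y|m c x y]; rewrite /tlift /fsum scaler_sumr -big_split /=;
  apply: eq_bigr => p _.
- by rewrite mulrDl ftenDl -scalerAl ftenZl.
- by rewrite mulrDl ftenDr -scalerAl ftenZr.
Qed.

Lemma tens_mul_ten a b a' b' : tens_mul (ften a b) (ften a' b') = ften (a * a') (b * b').
Proof.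
rewrite /tens_mul tlift_tensor; last exact: tlift_bilin.
by rewrite tlift_tensor.
Qed.

Lemma tens_mul_linl u : linear (tens_mul^~ u).
Proof. by apply: tlift_linear; apply: tlift_bilin. Qed.

Lemma tens_mul_linr t : linear (tens_mul t).
Proof.
move=> c u v; rewrite /tens_mul /tlift /fsum scaler_sumr -big_split /=.
by apply: eq_bigr => p _; exact: (tlift_linear (bal_inner p.1 p.2)).
Qed.

Lemma tens_mulDl : left_distributive tens_mul +%R.
Proof. by move=> t t' u; have := tens_mul_linl u 1 t t'; rewrite !scale1r. Qed.
Lemma tens_mulDr : right_distributive tens_mul +%R.
Proof. by move=> t u u'; have := tens_mul_linr t 1 u u'; rewrite !scale1r. Qed.
Lemma tens_mul0l t : tens_mul 0 t = 0.
Proof. by have := tens_mul_linl t (-1) 0 0; rewrite scaler0 addr0 scaleN1r addNr. Qed.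
Lemma tens_mul0r t : tens_mul t 0 = 0.
Proof. by have := tens_mul_linr t (-1) 0 0; rewrite scaler0 addr0 scaleN1r addNr. Qed.
Lemma tens_mul_suml (J : Type) (s : seq J) (f : J -> ftens A B) u :
  tens_mul (\sum_(j <- s) f j) u = \sum_(j <- s) tens_mul (f j) u.
Proof.
elim: s => [|j s ih]; first by rewrite !big_nil tens_mul0l.
by rewrite !big_cons tens_mulDl ih.
Qed.
Lemma tens_mul_sumr (J : Type) (s : seq J) (f : J -> ftens A B) t :
  tens_mul t (\sum_(j <- s) f j) = \sum_(j <- s) tens_mul t (f j).
Proof.
elim: s => [|j s ih]; first by rewrite !big_nil tens_mul0r.
by rewrite !big_cons tens_mulDr ih.
Qed.
Lemma tens_mulZl c t u : c *: tens_mul t u = tens_mul (c *: t) u.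
Proof. by have := tens_mul_linl u c t 0; rewrite tens_mul0l !addr0. Qed.
Lemma tens_mulZr c t u : c *: tens_mul t u = tens_mul t (c *: u).
Proof. by have := tens_mul_linr t c u 0; rewrite tens_mul0r !addr0. Qed.

Lemma tens_mulA : associative tens_mul.
Proof.
move=> t u v; elim/tens_ind: t => [a b||t t' h h'].
- elim/tens_ind: u => [a' b'||u u' h h'].
  + elim/tens_ind: v => [a'' b''||v v' h h'].
    * by rewrite !tens_mul_ten !mulrA.
    * by rewrite !tens_mul0r.
    * by rewrite !tens_mulDr h h'.
  + by rewrite !(tens_mul0r, tens_mul0l).
  + by rewrite !(tens_mulDr, tens_mulDl) h h'.
- by rewrite !tens_mul0l.
- by rewrite !tens_mulDl h h'.
Qed.
Lemma tens_mul1l : left_id (ften 1 1) tens_mul.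
Proof.
elim/tens_ind => [a b||t t' h h']; by rewrite ?tens_mul_ten ?mul1r ?tens_mul0r ?tens_mulDr ?h ?h'.
Qed.
Lemma tens_mul1r : right_id (ften 1 1) tens_mul.
Proof.
elim/tens_ind => [a b||t t' h h']; by rewrite ?tens_mul_ten ?mulr1 ?tens_mul0l ?tens_mulDl ?h ?h'.
Qed.
End TensorMul.

Section QuantumGroup.
Variables (C : fieldType) (g : simple_type) (q : C).
Local Notation I := 'I_(rank g).

Definition qi (i : I) : C := q ^+ sdiag i.

Record Uq_rels (A : algType C) (E F K K' : I -> A) : Prop := UqRels {
  rel_KV : forall i, K i * K' i = 1;
  rel_VK : forall i, K' i * K i = 1;
  rel_KK : forall i j, K i * K j = K j * K i;
  rel_KE : forall i j, K i * E j = (qi i ^ (g i j)) *: (E j * K i);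
  rel_KF : forall i j, K i * F j = (qi i ^ (- g i j)) *: (F j * K i);
  rel_EF : forall i j, E i * F j - F j * E i =
    if i == j then (qi i - (qi i)^-1)^-1 *: (K i - K' i) else 0;
  rel_EE : forall i j, i != j -> serre (qi i) `|1 - g i j|%N (E i) (E j) = 0;
  rel_FF : forall i j, i != j -> serre (qi i) `|1 - g i j|%N (F i) (F j) = 0
}.

(* U_q(g) is the quotient of the noncommutative polynomial expressions in the
   generators that identifies the expressions having equal values in every
   algebra where the defining relations hold, i.e. the algebra presented by
   these generators and relations (universal property: Uq_lift, Uq_ind,
   gen_rels). *)
Inductive uterm :=
  | UConst of C | UE of I | UF of I | UK of I | UKinv of I
  | UAdd of uterm & uterm | UMul of uterm & uterm.

HB.instance Definition _ := gen_eqMixin uterm.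
HB.instance Definition _ := gen_choiceMixin uterm.

Section Eval.
Variables (A : algType C) (E F K K' : I -> A).
Fixpoint ueval (t : uterm) : A :=
  match t with
  | UConst c => c%:A
  | UE i => E i | UF i => F i | UK i => K i | UKinv i => K' i
  | UAdd t u => ueval t + ueval u
  | UMul t u => ueval t * ueval u
  end.
End Eval.

Definition ueq (t u : uterm) : Prop :=
  forall (A : algType C) (E F K K' : I -> A), Uq_rels E F K K' ->
    ueval E F K K' t = ueval E F K K' u.

Definition ueqb (t u : uterm) : bool := `[< ueq t u >].
Lemma ueqb_refl : reflexive ueqb.
Proof. by move=> s; apply/asboolP. Qed.
Lemma ueqb_sym : symmetric ueqb.
Proof. by move=> s t; apply/asboolP/asboolP => h A E F K K' r; rewrite h. Qed.
Lemma ueqb_trans : transitive ueqb.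
Proof.
move=> t s u /asboolP h1 /asboolP h2; apply/asboolP => A E F K K' r.
by rewrite h1 // h2.
Qed.
Canonical ueq_equiv := EquivRel ueqb ueqb_refl ueqb_sym ueqb_trans.

Definition Uq : Type := {eq_quot ueq_equiv}.
HB.instance Definition _ := Choice.on Uq.
HB.instance Definition _ := EqQuotient.on Uq.

Lemma Uq_piP t u : reflect (ueq t u) (\pi_Uq t == \pi_Uq u).
Proof. by rewrite eqmodE; apply: asboolP. Qed.

Section Lift.
Variables (A : algType C) (E F K K' : I -> A).
Definition Uq_lift (X : Uq) : A := ueval E F K K' (repr X).
Lemma Uq_lift_pi t : Uq_rels E F K K' -> Uq_lift (\pi_Uq t) = ueval E F K K' t.
Proof.
move=> r; rewrite /Uq_lift.
by have /eqP/Uq_piP -> := reprK (\pi_Uq t).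
Qed.
End Lift.

Lemma Uq_extP (X Y : Uq) :
  (forall (A : algType C) (E F K K' : I -> A), Uq_rels E F K K' ->
     Uq_lift E F K K' X = Uq_lift E F K K' Y) -> X = Y.
Proof. by move=> h; rewrite -[X]reprK -[Y]reprK; apply/eqP/Uq_piP. Qed.

Definition Uq_add (X Y : Uq) : Uq := \pi_Uq (UAdd (repr X) (repr Y)).
Definition Uq_mul (X Y : Uq) : Uq := \pi_Uq (UMul (repr X) (repr Y)).
Definition Uq_const (c : C) : Uq := \pi_Uq (UConst c).
Definition Uq_opp (X : Uq) : Uq := Uq_mul (Uq_const (-1)) X.
Definition Uq_scale (c : C) (X : Uq) : Uq := Uq_mul (Uq_const c) X.

Lemma lift_add (A : algType C) (E F K K' : I -> A) X Y : Uq_rels E F K K' ->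
  Uq_lift E F K K' (Uq_add X Y) = Uq_lift E F K K' X + Uq_lift E F K K' Y.
Proof. by move=> r; rewrite Uq_lift_pi. Qed.
Lemma lift_mul (A : algType C) (E F K K' : I -> A) X Y : Uq_rels E F K K' ->
  Uq_lift E F K K' (Uq_mul X Y) = Uq_lift E F K K' X * Uq_lift E F K K' Y.
Proof. by move=> r; rewrite Uq_lift_pi. Qed.
Lemma lift_const (A : algType C) (E F K K' : I -> A) c : Uq_rels E F K K' ->
  Uq_lift E F K K' (Uq_const c) = c%:A.
Proof. by move=> r; rewrite Uq_lift_pi. Qed.

Ltac uq_ext := repeat intro; apply: Uq_extP => A E F K K' r;
  rewrite /Uq_opp /Uq_scale ?(lift_add, lift_mul, lift_const) //.

Lemma Uq_addA : associative Uq_add.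
Proof. by uq_ext; rewrite addrA. Qed.
Lemma Uq_addC : commutative Uq_add.
Proof. by uq_ext; rewrite addrC. Qed.
Lemma Uq_add0 : left_id (Uq_const 0) Uq_add.
Proof. by uq_ext; rewrite scale0r add0r. Qed.
Lemma Uq_addN : left_inverse (Uq_const 0) Uq_opp Uq_add.
Proof. by uq_ext; rewrite -scalerAl mul1r scaleN1r addNr scale0r. Qed.
HB.instance Definition _ :=
  GRing.isZmodule.Build Uq Uq_addA Uq_addC Uq_add0 Uq_addN.

Lemma Uq_mulA : associative Uq_mul.
Proof. by uq_ext; rewrite mulrA. Qed.
Lemma Uq_mul1l : left_id (Uq_const 1) Uq_mul.
Proof. by uq_ext; rewrite scale1r mul1r. Qed.
Lemma Uq_mul1r : right_id (Uq_const 1) Uq_mul.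
Proof. by uq_ext; rewrite scale1r mulr1. Qed.
Lemma Uq_mulDl : left_distributive Uq_mul Uq_add.
Proof. by uq_ext; rewrite mulrDl. Qed.
Lemma Uq_mulDr : right_distributive Uq_mul Uq_add.
Proof. by uq_ext; rewrite mulrDr. Qed.

Lemma counit_rels : Uq_rels (fun=> 0 : C^o) (fun=> 0) (fun=> 1) (fun=> 1).
Proof.
split=> *; rewrite ?mulr1 ?mulr0 ?mul0r ?scaler0 ?serre0 //.
by rewrite !subrr scaler0 if_same.
Qed.

Definition counit (X : Uq) : C :=
  Uq_lift (fun=> 0 : C^o) (fun=> 0) (fun=> 1) (fun=> 1) X.

Lemma Uq_nz : Uq_const 1 != 0 :> Uq.
Proof.
apply/eqP => /(congr1 counit); rewrite /counit !lift_const; [|exact: counit_rels..].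
by rewrite scale1r scale0r => /eqP; rewrite oner_eq0.
Qed.
HB.instance Definition _ := GRing.Zmodule_isNzRing.Build Uq
  Uq_mulA Uq_mul1l Uq_mul1r Uq_mulDl Uq_mulDr Uq_nz.

Lemma Uq_scaleA a b X : Uq_scale a (Uq_scale b X) = Uq_scale (a * b) X.
Proof. by uq_ext; rewrite -!scalerAl !mul1r scalerA. Qed.
Lemma Uq_scale1 : left_id 1 Uq_scale.
Proof. by uq_ext; rewrite -!scalerAl !mul1r scale1r. Qed.
Lemma Uq_scaleDr : right_distributive Uq_scale +%R.
Proof. by move=> c X Y; exact: mulrDr. Qed.
Lemma Uq_scaleDl X : {morph Uq_scale^~ X : a b / a + b}.
Proof.
move=> a b; apply: Uq_extP => A E F K K' r; rewrite /Uq_scale.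
by rewrite !(lift_add, lift_mul, lift_const) // -!scalerAl !mul1r scalerDl.
Qed.
HB.instance Definition _ := GRing.Zmodule_isLmodule.Build C Uq
  Uq_scaleA Uq_scale1 Uq_scaleDr Uq_scaleDl.
Lemma Uq_scaleAl (a : C) (X Y : Uq) : a *: (X * Y) = (a *: X) * Y.
Proof. exact: mulrA. Qed.
HB.instance Definition _ := GRing.Lmodule_isLalgebra.Build C Uq Uq_scaleAl.
Lemma Uq_scaleAr (a : C) (X Y : Uq) : a *: (X * Y) = X * (a *: Y).
Proof.
apply: Uq_extP => A E F K K' r; rewrite /GRing.scale /GRing.mul /= /Uq_scale.
by rewrite !(lift_mul, lift_const) // -!scalerAl !mul1r scalerAr.
Qed.
HB.instance Definition _ := GRing.Lalgebra_isAlgebra.Build C Uq Uq_scaleAr.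

Definition gE i : Uq := \pi_Uq (UE i).
Definition gF i : Uq := \pi_Uq (UF i).
Definition gK i : Uq := \pi_Uq (UK i).
Definition gKinv i : Uq := \pi_Uq (UKinv i).

Section LiftMorphism.
Variables (A : algType C) (E F K K' : I -> A).
Hypothesis r : Uq_rels E F K K'.
Local Notation f := (Uq_lift E F K K').

Lemma Uq_liftM X Y : f (X * Y) = f X * f Y.
Proof. exact: lift_mul. Qed.
Lemma Uq_lift1 : f 1 = 1.
Proof. by rewrite lift_const // scale1r. Qed.
Lemma Uq_liftD X Y : f (X + Y) = f X + f Y.
Proof. exact: lift_add. Qed.
Lemma Uq_liftZ c X : f (c *: X) = c *: f X.
Proof. by rewrite [LHS]lift_mul // lift_const // -scalerAl mul1r. Qed.
Lemma Uq_lift_linear : linear f.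
Proof. by move=> c X Y; rewrite Uq_liftD Uq_liftZ. Qed.
Lemma Uq_lift0 : f 0 = 0.
Proof. by rewrite -[X in f X](scale0r 0) Uq_liftZ scale0r. Qed.
Lemma Uq_liftB X Y : f (X - Y) = f X - f Y.
Proof. by rewrite -!scaleN1r Uq_liftD Uq_liftZ. Qed.
Lemma Uq_liftE i : f (gE i) = E i. Proof. exact: Uq_lift_pi. Qed.
Lemma Uq_liftF i : f (gF i) = F i. Proof. exact: Uq_lift_pi. Qed.
Lemma Uq_liftK i : f (gK i) = K i. Proof. exact: Uq_lift_pi. Qed.
Lemma Uq_liftKinv i : f (gKinv i) = K' i. Proof. exact: Uq_lift_pi. Qed.
End LiftMorphism.

Lemma Uq_ind (P : Uq -> Prop) :
  (forall c, P c%:A) -> (forall i, P (gE i)) -> (forall i, P (gF i)) ->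
  (forall i, P (gK i)) -> (forall i, P (gKinv i)) ->
  (forall X Y, P X -> P Y -> P (X + Y)) -> (forall X Y, P X -> P Y -> P (X * Y)) ->
  forall X, P X.
Proof.
move=> h1 hE hF hK hK' hD hM X; rewrite -[X]reprK.
elim: (repr X) => [c|||||t ht u hu|t ht u hu]; try by [].
- have -> : \pi_Uq (UConst c) = c%:A.
    apply: Uq_extP => A E F K K' r.
    by rewrite Uq_liftZ // Uq_lift1 // Uq_lift_pi.
  exact: h1.
- have -> : \pi_Uq (UAdd t u) = \pi_Uq t + \pi_Uq u.
    by apply: Uq_extP => A E F K K' r; rewrite Uq_liftD // !Uq_lift_pi.
  exact: hD.
- have -> : \pi_Uq (UMul t u) = \pi_Uq t * \pi_Uq u.
    by apply: Uq_extP => A E F K K' r; rewrite Uq_liftM // !Uq_lift_pi.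
  exact: hM.
Qed.

Lemma ueval_serre (A : algType C) (f : Uq -> A) v m X Y :
  linear f -> f 1 = 1 -> {morph f : x y / x * y} ->
  f (serre v m X Y) = serre v m (f X) (f Y).
Proof.
move=> lf f1 fM.
pose f' : {linear Uq -> A} := HB.pack f (GRing.isLinear.Build _ _ _ _ _ lf).
have fX n Z : f (Z ^+ n) = f Z ^+ n.
  by elim: n => // n ih; rewrite !exprS fM ih.
rewrite /serre -[LHS]/(f' _) raddf_sum /=; apply: eq_bigr => k _.
by rewrite -[LHS]/(f' _) linearZ /= !fM !fX.
Qed.

Lemma gen_rels : Uq_rels gE gF gK gKinv.
Proof.
have H (X Y : Uq) : (forall (A : algType C) (E F K K' : I -> A), Uq_rels E F K K' ->
     Uq_lift E F K K' X = Uq_lift E F K K' Y) -> X = Y by exact: Uq_extP.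
split=> *; apply: H => A E F K K' r; have L := Uq_lift_linear r.
- by rewrite Uq_liftM // Uq_lift1 // Uq_liftK // Uq_liftKinv // (rel_KV r).
- by rewrite Uq_liftM // Uq_lift1 // Uq_liftK // Uq_liftKinv // (rel_VK r).
- by rewrite !Uq_liftM // !Uq_liftK // (rel_KK r).
- by rewrite Uq_liftZ // !Uq_liftM // !Uq_liftK // !Uq_liftE // (rel_KE r).
- by rewrite Uq_liftZ // !Uq_liftM // !Uq_liftK // !Uq_liftF // (rel_KF r).
- rewrite Uq_liftB // !Uq_liftM // Uq_liftE // Uq_liftF // (rel_EF r).
  case: eqP => _; last by rewrite Uq_lift0.
  by rewrite Uq_liftZ // Uq_liftB // Uq_liftK // Uq_liftKinv.
- rewrite ueval_serre ?Uq_lift1 //; last by move=> *; rewrite Uq_liftM.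
  by rewrite !Uq_liftE // (rel_EE r) // Uq_lift0.
- rewrite ueval_serre ?Uq_lift1 //; last by move=> *; rewrite Uq_liftM.
  by rewrite !Uq_liftF // (rel_FF r) // Uq_lift0.
Qed.
End QuantumGroup.


Section Coproduct.
Variables (C : fieldType) (g : simple_type) (q : C).
Local Notation I := 'I_(rank g).
Local Notation U := (Uq g q).

Definition Uq2 : Type := ftens U U.
HB.instance Definition _ := GRing.Lmodule.on Uq2.

Lemma counit1 : counit (1 : U) = 1.
Proof. exact: (Uq_lift1 (counit_rels g q)). Qed.
Lemma counitM (X Y : U) : counit (X * Y) = counit X * counit Y.
Proof. exact: (Uq_liftM (counit_rels g q)). Qed.
Lemma counit_linear : linear (@counit C g q : U -> C^o).
Proof. exact: (Uq_lift_linear (counit_rels g q)). Qed.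

Lemma Uq2_nz : ften 1 1 != 0 :> Uq2.
Proof.
have hb : balanced (@scale_r _ U) (@scale_l _ U)
    (fun a b => counit a * counit b : C^o).
  apply: fbalanced => [n c x y|m c x y].
    by rewrite counit_linear mulrDl; congr (_ + _); rewrite /GRing.scale /= mulrA.
  by rewrite counit_linear mulrDr; congr (_ + _); rewrite /GRing.scale /= mulrCA.
apply/eqP => /(congr1 (tlift (fun a b : U => counit a * counit b : C^o))).
rewrite tlift_tensor // tens_zeroE // counit1 mulr1.
by move/eqP; rewrite oner_eq0.
Qed.
HB.instance Definition _ := GRing.Zmodule_isNzRing.Build Uq2
  (@tens_mulA C U U) (@tens_mul1l C U U) (@tens_mul1r C U U)
  (@tens_mulDl C U U) (@tens_mulDr C U U) Uq2_nz.
HB.instance Definition _ := GRing.Lmodule_isLalgebra.Build C Uq2 (@tens_mulZl C U U).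
HB.instance Definition _ := GRing.Lalgebra_isAlgebra.Build C Uq2 (@tens_mulZr C U U).

Definition ten (a b : U) : Uq2 := ften a b.

Lemma tenM a b a' b' : ten a b * ten a' b' = ten (a * a') (b * b').
Proof. exact: tens_mul_ten. Qed.
Lemma tenX a b n : ten a b ^+ n = ten (a ^+ n) (b ^+ n).
Proof. by elim: n => // n ih; rewrite !exprS ih tenM. Qed.
Lemma tenZl c a b : ten (c *: a) b = c *: ten a b. Proof. exact: ftenZl. Qed.
Lemma tenZr c a b : ten a (c *: b) = c *: ten a b. Proof. exact: ftenZr. Qed.
Lemma tenDl a a' b : ten (a + a') b = ten a b + ten a' b. Proof. exact: ftenDl. Qed.
Lemma tenDr a b b' : ten a (b + b') = ten a b + ten a b'. Proof. exact: ftenDr. Qed.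
Lemma tenBl a a' b : ten (a - a') b = ten a b - ten a' b.
Proof. by rewrite -!scaleN1r tenDl tenZl. Qed.
Lemma tenBr a b b' : ten a (b - b') = ten a b - ten a b'.
Proof. by rewrite -!scaleN1r tenDr tenZr. Qed.
Lemma ten0l b : ten 0 b = 0. Proof. exact: ften0l. Qed.
Lemma ten0r a : ten a 0 = 0. Proof. exact: ften0r. Qed.
Lemma ten_suml (J : Type) (s : seq J) (P : pred J) (f : J -> U) b :
  ten (\sum_(j <- s | P j) f j) b = \sum_(j <- s | P j) ten (f j) b.
Proof.
elim/big_rec2: _ => [|j y1 y2 _ <-]; first exact: ten0l.
by rewrite tenDl.
Qed.
Lemma ten_sumr (J : Type) (s : seq J) (P : pred J) (f : J -> U) a :
  ten a (\sum_(j <- s | P j) f j) = \sum_(j <- s | P j) ten a (f j).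
Proof.
elim/big_rec2: _ => [|j y1 y2 _ <-]; first exact: ten0r.
by rewrite tenDr.
Qed.

Lemma comm_pow (x y : U) m k : x * y = y * x -> (k <= m)%N ->
  x ^+ (m - k) * y * x ^+ k = x ^+ m * y.
Proof.
move=> xy km; have /(commrX k) h : GRing.comm y x by [].
by rewrite -mulrA h mulrA -exprD subnK.
Qed.

Lemma serre_tenl v m (a b x y : U) : x * y = y * x ->
  serre v m (ten a x) (ten b y) = ten (serre v m a b) (x ^+ m * y).
Proof.
move=> xy; rewrite /serre ten_suml; apply: eq_bigr => k _.
by rewrite !tenX !tenM tenZl (comm_pow xy) // -ltnS.
Qed.
Lemma serre_tenr v m (a b x y : U) : x * y = y * x ->
  serre v m (ten x a) (ten y b) = ten (x ^+ m * y) (serre v m a b).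
Proof.
move=> xy; rewrite /serre ten_sumr; apply: eq_bigr => k _.
by rewrite !tenX !tenM tenZr (comm_pow xy) // -ltnS.
Qed.

Local Notation E := (@gE C g q).
Local Notation F := (@gF C g q).
Local Notation K := (@gK C g q).
Local Notation K' := (@gKinv C g q).
Local Notation R := (gen_rels g q).

Definition coE i : Uq2 := ften (E i) (K i) + ften 1 (E i).
Definition coF i : Uq2 := ften (F i) 1 + ften (K' i) (F i).
Definition coK i : Uq2 := ften (K i) (K i).
Definition coKinv i : Uq2 := ften (K' i) (K' i).

Implicit Types (i j : I).

Lemma qi_sym i j : qi q i ^ (g i j) = qi q j ^ (g j i).
Proof. by rewrite /qi !exprnP !exprz_exp cartan_sym. Qed.

Lemma VK_comm i j : K' i * K j = K j * K' i.
Proof.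
by rewrite -[LHS]mulr1 -(rel_KV R i) !mulrA -[_ * K j * K i]mulrA -(rel_KK R i j)
  !mulrA (rel_VK R) mul1r.
Qed.
Lemma VV_comm i j : K' i * K' j = K' j * K' i.
Proof.
by rewrite -[LHS]mulr1 -(rel_KV R i) !mulrA -[_ * K' j * K i]mulrA VK_comm
  !mulrA (rel_VK R) mul1r.
Qed.
Lemma qi_inv i (n : int) : q != 0 -> qi q i ^ n * qi q i ^ (- n) = 1.
Proof. by move=> q0; rewrite -expfzDr ?expf_neq0 // subrr expr0z. Qed.

Lemma VE i j : q != 0 -> K' i * E j = (qi q i ^ (- g i j)) *: (E j * K' i).
Proof.
move=> q0; have h := rel_KE R i j.
have -> : E j * K' i = K' i * (K i * E j) * K' i by rewrite mulrA (rel_VK R) mul1r.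
rewrite h -scalerAr -scalerAl scalerA mulrC qi_inv // scale1r.
by rewrite -!mulrA (rel_KV R) mulr1.
Qed.
Lemma VF i j : q != 0 -> K' i * F j = (qi q i ^ (g i j)) *: (F j * K' i).
Proof.
move=> q0; have h := rel_KF R i j.
have -> : F j * K' i = K' i * (K i * F j) * K' i by rewrite mulrA (rel_VK R) mul1r.
rewrite h -scalerAr -scalerAl scalerA qi_inv // scale1r.
by rewrite -!mulrA (rel_KV R) mulr1.
Qed.

Lemma EF0 i : q = 0 -> E i = 0 /\ F i = 0.
Proof.
move=> q0; have h (n : int) : n != 0 -> qi q i ^ n = 0.
  by move=> n0; rewrite /qi q0 expr0n gtn_eqF ?sdiag_gt0 //= exp0rz (negPf n0).
split.
  have := rel_KE R i i; rewrite cartan_diag h // scale0r => /(congr1 ( *%R (K' i))).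
  by rewrite mulrA (rel_VK R) mul1r mulr0.
have := rel_KF R i i; rewrite cartan_diag h // scale0r => /(congr1 ( *%R (K' i))).
by rewrite mulrA (rel_VK R) mul1r mulr0.
Qed.

Lemma coprod_rels : Uq_rels q coE coF coK coKinv.
Proof.
rewrite /coE /coF /coK /coKinv -!/(ten _ _).
have KE i j : ten (K i) (K i) * (ten (E j) (K j) + ten 1 (E j)) =
    (qi q i ^ (g i j)) *: ((ten (E j) (K j) + ten 1 (E j)) * ten (K i) (K i)).
  rewrite mulrDr mulrDl !tenM !(rel_KE R) tenZl tenZr (rel_KK R i j) scalerDr.
  by rewrite !mulr1 !mul1r.
have KF i j : ten (K i) (K i) * (ten (F j) 1 + ten (K' j) (F j)) =
    (qi q i ^ (- g i j)) *: ((ten (F j) 1 + ten (K' j) (F j)) * ten (K i) (K i)).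
  rewrite mulrDr mulrDl !tenM !(rel_KF R) tenZl tenZr -VK_comm scalerDr.
  by rewrite !mulr1 !mul1r.
have [q0|q0] := eqVneq q 0.
  have Z i : E i = 0 /\ F i = 0 by exact: EF0.
  have coE0 i : ten (E i) (K i) + ten 1 (E i) = 0.
    by rewrite (Z i).1 ten0l ten0r addr0.
  have coF0 i : ten (F i) 1 + ten (K' i) (F i) = 0.
    by rewrite (Z i).2 ten0l ten0r addr0.
  split=> // [i|i|i j|i j|i j|i j].
  - by rewrite tenM (rel_KV R).
  - by rewrite tenM (rel_VK R).
  - by rewrite !tenM (rel_KK R).
  - rewrite !coE0 !mul0r !mulr0 subrr; case: eqP => // _.
    have qi0 : qi q i = 0 by rewrite /qi q0 expr0n gtn_eqF ?sdiag_gt0.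
    by rewrite qi0 invr0 subrr invr0 scale0r.
  - by rewrite !coE0 serre0.
  - by rewrite !coF0 serre0.
have v0 i : qi q i != 0 by rewrite expf_neq0.
have m_gt i j : i != j -> qi q i ^+ `|1 - g i j|%N.-1 = qi q i ^ (- g i j).
  move=> ij; have := cartan_offdiag ij; rewrite exprnP => h.
  by congr (_ ^ _); lia.
have qimi i j : qi q i ^ (- g i j) * qi q i ^ (g i j) = 1.
  by rewrite mulrC qi_inv.
split=> // [i|i|i j|i j|i j ij|i j ij].
- by rewrite tenM (rel_KV R).
- by rewrite tenM (rel_VK R).
- by rewrite !tenM (rel_KK R).
- rewrite !mulrDl !mulrDr !tenM !mul1r !mulr1.
  have -> : ten (E i * K' j) (K i * F j) = ten (K' j * E i) (F j * K i).
    rewrite (rel_KF R) VE // tenZl tenZr; congr (_ *: _).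
    apply: (can_inj (mulKf (_ : qi q i ^ g i j != 0))) => //.
      by rewrite expfz_neq0.
    by rewrite qi_inv // qi_sym qi_inv.
  have -> : ten (E i * F j) (K i) = ten (F j * E i) (K i) +
     ten (if i == j then (qi q i - (qi q i)^-1)^-1 *: (K i - K' i) else 0) (K i).
    by rewrite -(rel_EF R) -tenDl addrC subrK.
  have -> : ten (K' j) (E i * F j) = ten (K' j) (F j * E i) +
     ten (K' j) (if i == j then (qi q i - (qi q i)^-1)^-1 *: (K i - K' i) else 0).
    by rewrite -(rel_EF R) -tenDr addrC subrK.
  set X := ten (F j * E i) (K i); set Y := ten (F j) (E i).
  set Z := ten (K' j * E i) (F j * K i); set W := ten (K' j) (F j * E i).
  set P := ten (if _ then _ else _) _; set Q := ten _ (if _ then _ else _).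
  transitivity (P + Q).
    rewrite (_ : X + P + Z + (Y + (W + Q)) = (P + Q) + (X + Y + (Z + W))); last first.
      by rewrite [X + P]addrC -!addrA; congr (_ + _);
         rewrite [RHS]addrCA; congr (_ + _); rewrite [LHS]addrCA;
         rewrite [RHS]addrC -!addrA; congr (_ + _); congr (_ + _); rewrite addrC.
    by rewrite addrK.
  rewrite /P /Q; case: eqP => [->|_]; last by rewrite ten0l ten0r addr0.
  rewrite tenZl tenZr -scalerDr tenBl tenBr; congr (_ *: _).
  by rewrite addrA subrK.
- have qinv (n : int) (x y : Uq2) : x = qi q i ^ n *: y -> y = qi q i ^ (- n) *: x.
    by move=> ->; rewrite scalerA mulrC qi_inv // scale1r.
  rewrite (serre_add (v0 i)).
  + rewrite (serre_tenl _ _ _ _ (rel_KK R i j)) (serre_tenr _ _ _ _ (erefl (1 * 1))).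
    by rewrite (rel_EE R ij) ten0l ten0r addr0.
  + by rewrite !tenM (rel_KE R) cartan_diag !mul1r !mulr1 tenZr.
  + rewrite m_gt //; apply: (qinv (g i j)).
    by rewrite !tenM (rel_KE R) !mul1r !mulr1 tenZr qi_sym.
  + rewrite m_gt //; apply: (qinv (g i j)).
    by rewrite !tenM (rel_KE R) !mul1r !mulr1 tenZr.
- have qinv (n : int) (x y : Uq2) : x = qi q i ^ n *: y -> y = qi q i ^ (- n) *: x.
    by move=> ->; rewrite scalerA mulrC qi_inv // scale1r.
  rewrite [ten (F i) 1 + _]addrC [ten (F j) 1 + _]addrC.
  rewrite (serre_add (v0 i)).
  + rewrite (serre_tenr _ _ _ _ (VV_comm i j)) (serre_tenl _ _ _ _ (erefl (1 * 1))).
    by rewrite (rel_FF R ij) ten0l ten0r addr0.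
  + by rewrite !tenM VF // cartan_diag !mul1r !mulr1 tenZl.
  + rewrite m_gt //; apply: (qinv (g i j)).
    by rewrite !tenM VF // !mul1r !mulr1 tenZl qi_sym.
  + rewrite m_gt //; apply: (qinv (g i j)).
    by rewrite !tenM VF // !mul1r !mulr1 tenZl.
Qed.
End Coproduct.


Section TensorMap.
Variables (C : fieldType) (M N M' N' : lmodType C) (f : M -> M') (h : N -> N').
Hypotheses (lf : linear f) (lh : linear h).
Definition tens_map (t : ftens M N) : ftens M' N' := tlift (fun a b => ften (f a) (h b)) t.
Lemma tens_map_bal : balanced (@scale_r _ M) (@scale_l _ N) (fun a b => ften (f a) (h b)).
Proof.
apply: fbalanced => [n c x y|m c x y].
  by rewrite lf ftenDl ftenZl.
by rewrite lh ftenDr ftenZr.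
Qed.
Lemma tens_map_ten a b : tens_map (ften a b) = ften (f a) (h b).
Proof. by rewrite /tens_map tlift_tensor //; exact: tens_map_bal. Qed.
Lemma tens_map_linear : linear tens_map.
Proof. by apply: tlift_linear; exact: tens_map_bal. Qed.
End TensorMap.

Lemma lin0 (C : pzRingType) (M N : lmodType C) (f : M -> N) : linear f -> f 0 = 0.
Proof. by move=> lf; have := lf (-1) 0 0; rewrite scaler0 addr0 scaleN1r addNr. Qed.
Lemma linD (C : pzRingType) (M N : lmodType C) (f : M -> N) : linear f -> {morph f : x y / x + y}.
Proof. by move=> lf x y; have := lf 1 x y; rewrite !scale1r. Qed.
Lemma linZ (C : pzRingType) (M N : lmodType C) (f : M -> N) c x : linear f -> f (c *: x) = c *: f x.
Proof. by move=> lf; have := lf c x 0; rewrite !addr0 lin0 // addr0. Qed.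

Section TensorMapMul.
Variables (C : fieldType) (A B A' B' : algType C) (f : A -> A') (h : B -> B').
Hypotheses (lf : linear f) (lh : linear h).
Hypotheses (fM : {morph f : x y / x * y}) (hM : {morph h : x y / x * y}).
Lemma tens_mapM t u :
  tens_map f h (tens_mul t u) = tens_mul (tens_map f h t) (tens_map f h u).
Proof.
have L := tens_map_linear lf lh.
elim/tens_ind: t => [a b||t t' e e'].
- elim/tens_ind: u => [a' b'||u u' e e'].
  + by rewrite tens_mul_ten !tens_map_ten // tens_mul_ten fM hM.
  + by rewrite tens_mul0r (lin0 L) tens_mul0r.
  + by rewrite tens_mulDr !(linD L) tens_mulDr e e'.
- by rewrite tens_mul0l (lin0 L) tens_mul0l.
- by rewrite tens_mulDl !(linD L) tens_mulDl e e'.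
Qed.
End TensorMapMul.

Section Coprod.
Variables (C : fieldType) (g : simple_type) (q : C).
Local Notation U := (Uq g q).
Local Notation U2 := (Uq2 g q).

Definition coprod (X : U) : U2 :=
  Uq_lift (@coE C g q) (@coF C g q) (@coK C g q) (@coKinv C g q) X.

Lemma coprod_linear : linear coprod.
Proof. exact: Uq_lift_linear (coprod_rels g q). Qed.
Lemma coprodM : {morph coprod : X Y / X * Y}.
Proof. by move=> X Y; exact: Uq_liftM (coprod_rels g q) _ _. Qed.
Lemma coprod1 : coprod 1 = ften 1 1.
Proof. exact: Uq_lift1 (coprod_rels g q). Qed.
Lemma coprodE i : coprod (gE q i) = ften (gE q i) (gK q i) + ften 1 (gE q i).
Proof. exact: Uq_liftE (coprod_rels g q) i. Qed.
Lemma coprodF i : coprod (gF q i) = ften (gF q i) 1 + ften (gKinv q i) (gF q i).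
Proof. exact: Uq_liftF (coprod_rels g q) i. Qed.
Lemma coprodK i : coprod (gK q i) = ften (gK q i) (gK q i).
Proof. exact: Uq_liftK (coprod_rels g q) i. Qed.
Lemma coprodKinv i : coprod (gKinv q i) = ften (gKinv q i) (gKinv q i).
Proof. exact: Uq_liftKinv (coprod_rels g q) i. Qed.

Lemma id_linear (M : lmodType C) : linear (fun x : M => x).
Proof. by []. Qed.
Lemma counitE i : counit (gE q i : U) = 0.
Proof. exact: Uq_liftE (counit_rels g q) i. Qed.
Lemma counitF i : counit (gF q i : U) = 0.
Proof. exact: Uq_liftF (counit_rels g q) i. Qed.
Lemma counitK i : counit (gK q i : U) = 1.
Proof. exact: Uq_liftK (counit_rels g q) i. Qed.
Lemma counitKinv i : counit (gKinv q i : U) = 1.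
Proof. exact: Uq_liftKinv (counit_rels g q) i. Qed.

Local Notation G1 := (@tens_map C U U U2 U coprod id).
Local Notation G2 := (@tens_map C U U U U2 id coprod).

Lemma coassoc X : exists s : seq (U * U * U),
  G1 (coprod X) = \sum_(p <- s) ften (ten p.1.1 p.1.2) p.2 /\
  G2 (coprod X) = \sum_(p <- s) ften p.1.1 (ten p.1.2 p.2).
Proof.
have L1 : linear G1 by apply: tens_map_linear => //; exact: coprod_linear.
have L2 : linear G2 by apply: tens_map_linear => //; exact: coprod_linear.
have T1 a b : G1 (ften a b) = ften (coprod a) b.
  by apply: tens_map_ten => //; exact: coprod_linear.
have T2 a b : G2 (ften a b) = ften a (coprod b).
  by apply: tens_map_ten => //; exact: coprod_linear.
elim/Uq_ind: X => [c|i|i|i|i|X Y [s [s1 s2]] [t [t1 t2]]|X Y [s [s1 s2]] [t [t1 t2]]].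
- exists [:: (c%:A, 1, 1)]; rewrite !big_seq1 /= (linZ _ _ coprod_linear) coprod1.
  rewrite (linZ _ _ L1) (linZ _ _ L2) T1 T2 coprod1.
  by rewrite tenZl !ftenZl.
- exists [:: (gE q i, gK q i, gK q i); (1, gE q i, gK q i); (1, 1, gE q i)].
  rewrite !big_cons !big_nil !addr0 /= coprodE (linD L1) (linD L2) !T1 !T2.
  by rewrite coprodE coprodK coprod1 -!/(ten _ _) [ften (_ + _) _]ftenDl [ften 1 (_ + _)]ftenDr !addrA.
- exists [:: (gF q i, 1, 1); (gKinv q i, gF q i, 1); (gKinv q i, gKinv q i, gF q i)].
  rewrite !big_cons !big_nil !addr0 /= coprodF (linD L1) (linD L2) !T1 !T2.
  by rewrite coprodF coprodKinv coprod1 -!/(ten _ _) [ften (_ + _) _]ftenDl [ften (gKinv q i) (_ + _)]ftenDr !addrA.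
- by exists [:: (gK q i, gK q i, gK q i)]; rewrite !big_seq1 /= coprodK T1 T2 coprodK.
- exists [:: (gKinv q i, gKinv q i, gKinv q i)].
  by rewrite !big_seq1 /= coprodKinv T1 T2 coprodKinv.
- exists (s ++ t); rewrite !big_cat /= (linD coprod_linear) (linD L1) (linD L2).
  by rewrite s1 s2 t1 t2.
- exists [seq (p.1.1 * r.1.1, p.1.2 * r.1.2, p.2 * r.2) | p <- s, r <- t].
  rewrite coprodM !big_allpairs_dep /=.
  have M1 : G1 (coprod X * coprod Y) = tens_mul (G1 (coprod X)) (G1 (coprod Y)).
    by apply: tens_mapM => //; [exact: coprod_linear|exact: coprodM].
  have M2 : G2 (coprod X * coprod Y) = tens_mul (G2 (coprod X)) (G2 (coprod Y)).
    by apply: tens_mapM => //; [exact: coprod_linear|exact: coprodM].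
  rewrite M1 M2 s1 s2 t1 t2; split.
  + rewrite tens_mul_suml.
    apply: eq_bigr => p _.
    rewrite tens_mul_sumr.
    by apply: eq_bigr => r _; rewrite tens_mul_ten tenM.
  + rewrite tens_mul_suml.
    apply: eq_bigr => p _.
    rewrite tens_mul_sumr.
    by apply: eq_bigr => r _; rewrite tens_mul_ten tenM.
Qed.

Lemma counit_l_bal : balanced (@scale_r _ U) (@scale_l _ U) (fun a b => counit a *: b).
Proof.
apply: fbalanced => [n c x y|m c x y].
  by rewrite counit_linear scalerDl -scalerA.
by rewrite scalerDr !scalerA mulrC.
Qed.
Lemma counit_r_bal : balanced (@scale_r _ U) (@scale_l _ U) (fun a b => counit b *: a).
Proof.
apply: fbalanced => [n c x y|m c x y].
  by rewrite scalerDr !scalerA mulrC.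
by rewrite counit_linear scalerDl -scalerA.
Qed.

Lemma tens_tlift_mul (beta : U -> U -> U) (t u : U2) :
  balanced (@scale_r _ U) (@scale_l _ U) beta ->
  (forall a b a' b', beta (a * a') (b * b') = beta a b * beta a' b') ->
  tlift beta (t * u) = tlift beta t * tlift beta u.
Proof.
move=> hb hM; have L := tlift_linear hb; have Z := tens_zeroE hb.
rewrite -[t * u]/(tens_mul t u).
elim/tens_ind: t => [a b||t t' e e'].
- elim/tens_ind: u => [a' b'||u u' e e'].
  + by rewrite tens_mul_ten !tlift_tensor.
  + by rewrite tens_mul0r !(lin0 L) mulr0.
  + by rewrite tens_mulDr !(linD L) e e' -mulrDr.
- by rewrite tens_mul0l !(lin0 L) mul0r.
- by rewrite tens_mulDl !(linD L) e e' -mulrDl.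
Qed.

Lemma counit_coprodl X : tlift (fun a b : U => counit a *: b) (coprod X) = X.
Proof.
have L := tlift_linear counit_l_bal; have T := tlift_tensor _ _ counit_l_bal.
elim/Uq_ind: X => [c|i|i|i|i|X Y eX eY|X Y eX eY].
- rewrite (linZ _ _ coprod_linear) (linZ _ _ L) coprod1 T.
  by rewrite counit1 scale1r.
- by rewrite coprodE (linD L) !T counitE counit1 scale0r scale1r add0r.
- by rewrite coprodF (linD L) !T counitF counitKinv scale0r scale1r add0r.
- by rewrite coprodK T counitK scale1r.
- by rewrite coprodKinv T counitKinv scale1r.
- by rewrite (linD coprod_linear) (linD L) eX eY.
- rewrite coprodM tens_tlift_mul ?eX ?eY //; first exact: counit_l_bal.
  by move=> a b a' b'; rewrite counitM -scalerAl -scalerAr scalerA.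
Qed.
Lemma counit_coprodr X : tlift (fun a b : U => counit b *: a) (coprod X) = X.
Proof.
have L := tlift_linear counit_r_bal; have T := tlift_tensor _ _ counit_r_bal.
elim/Uq_ind: X => [c|i|i|i|i|X Y eX eY|X Y eX eY].
- rewrite (linZ _ _ coprod_linear) (linZ _ _ L) coprod1 T.
  by rewrite counit1 scale1r.
- by rewrite coprodE (linD L) !T counitE counitK scale0r scale1r addr0.
- by rewrite coprodF (linD L) !T counitF counit1 scale0r scale1r addr0.
- by rewrite coprodK T counitK scale1r.
- by rewrite coprodKinv T counitKinv scale1r.
- by rewrite (linD coprod_linear) (linD L) eX eY.
- rewrite coprodM tens_tlift_mul ?eX ?eY //; first exact: counit_r_bal.
  by move=> a b a' b'; rewrite counitM -scalerAl -scalerAr scalerA.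
Qed.

(* The full linear dual of U_q(g), an algebra for the convolution product
   (phi psi)(X) = phi(X_(1)) psi(X_(2)). *)
Record Uq_dual := Dual { dfun :> U -> C; dual_linear : linear (dfun : U -> C^o) }.
HB.instance Definition _ := gen_eqMixin Uq_dual.
HB.instance Definition _ := gen_choiceMixin Uq_dual.

Lemma dualP (phi psi : Uq_dual) : (forall X, phi X = psi X) -> phi = psi.
Proof.
case: phi psi => [f lf] [h lh] /= /funext e; subst h.
by congr Dual; exact: Prop_irrelevance.
Qed.

Implicit Types (phi psi chi : Uq_dual).

Lemma zero_subproof : linear (fun _ : U => 0 : C^o).
Proof. by move=> c X Y; rewrite scaler0 addr0. Qed.
Definition dual_zero := Dual zero_subproof.
Lemma add_subproof phi psi : linear (fun X : U => phi X + psi X : C^o).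
Proof. by move=> c X Y; rewrite !dual_linear scalerDr addrACA. Qed.
Definition dual_add phi psi := Dual (add_subproof phi psi).
Lemma scale_subproof c phi : linear (fun X : U => c * phi X : C^o).
Proof.
move=> d X Y; rewrite dual_linear mulrDr; congr (_ + _).
by rewrite /GRing.scale /= mulrCA.
Qed.
Definition dual_scale c phi := Dual (scale_subproof c phi).
Definition dual_opp phi := dual_scale (-1) phi.

Definition dual2 phi psi (t : U2) : C := tlift (fun a b : U => phi a * psi b : C^o) t.
Lemma dual2_bal phi psi :
  balanced (@scale_r _ U) (@scale_l _ U) (fun a b => phi a * psi b : C^o).
Proof.
apply: fbalanced => [n c x y|m c x y].
  by rewrite dual_linear mulrDl; congr (_ + _); rewrite /GRing.scale /= mulrA.
by rewrite dual_linear mulrDr; congr (_ + _); rewrite /GRing.scale /= mulrCA.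
Qed.
Lemma dual2_linear phi psi : linear (dual2 phi psi : U2 -> C^o).
Proof. by apply: tlift_linear; exact: dual2_bal. Qed.
Lemma dual2_ten phi psi a b : dual2 phi psi (ften a b) = phi a * psi b.
Proof. exact: tlift_tensor (dual2_bal phi psi). Qed.

Lemma conv_subproof phi psi :
  linear (fun X => dual2 phi psi (coprod X) : C^o).
Proof. by move=> c X Y; rewrite coprod_linear dual2_linear. Qed.
Definition conv phi psi := Dual (conv_subproof phi psi).
Definition dual_one := Dual (@counit_linear C g q).

Lemma dual_addA : associative dual_add.
Proof. by move=> *; apply: dualP => X /=; rewrite addrA. Qed.
Lemma dual_addC : commutative dual_add.
Proof. by move=> *; apply: dualP => X /=; rewrite addrC. Qed.
Lemma dual_add0 : left_id dual_zero dual_add.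
Proof. by move=> *; apply: dualP => X /=; rewrite add0r. Qed.
Lemma dual_addN : left_inverse dual_zero dual_opp dual_add.
Proof. by move=> *; apply: dualP => X /=; rewrite mulN1r addNr. Qed.
HB.instance Definition _ :=
  GRing.isZmodule.Build Uq_dual dual_addA dual_addC dual_add0 dual_addN.

Lemma dual_scaleA a b phi : dual_scale a (dual_scale b phi) = dual_scale (a * b) phi.
Proof. by apply: dualP => X /=; rewrite mulrA. Qed.
Lemma dual_scale1 : left_id 1 dual_scale.
Proof. by move=> phi; apply: dualP => X /=; rewrite mul1r. Qed.
Lemma dual_scaleDr : right_distributive dual_scale +%R.
Proof. by move=> c phi psi; apply: dualP => X /=; rewrite mulrDr. Qed.
Lemma dual_scaleDl phi : {morph dual_scale^~ phi : a b / a + b}.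
Proof. by move=> a b; apply: dualP => X /=; rewrite mulrDl. Qed.
HB.instance Definition _ := GRing.Zmodule_isLmodule.Build C Uq_dual
  dual_scaleA dual_scale1 dual_scaleDr dual_scaleDl.

Lemma dual2Dl phi phi' psi t : dual2 (phi + phi') psi t = dual2 phi psi t + dual2 phi' psi t.
Proof. by rewrite /dual2 /tlift /fsum -big_split; apply: eq_bigr => p _; rewrite mulrDl. Qed.
Lemma dual2Dr phi psi psi' t : dual2 phi (psi + psi') t = dual2 phi psi t + dual2 phi psi' t.
Proof. by rewrite /dual2 /tlift /fsum -big_split; apply: eq_bigr => p _; rewrite mulrDr. Qed.
Lemma dual2Zl c phi psi t : dual2 (c *: phi) psi t = c * dual2 phi psi t.
Proof. by rewrite /dual2 /tlift /fsum mulr_sumr; apply: eq_bigr => p _; rewrite mulrA. Qed.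
Lemma dual2Zr c phi psi t : dual2 phi (c *: psi) t = c * dual2 phi psi t.
Proof. by rewrite /dual2 /tlift /fsum mulr_sumr; apply: eq_bigr => p _; rewrite mulrCA. Qed.

Lemma convA : associative conv.
Proof.
move=> phi psi chi; apply: dualP => X /=.
have [s [s1 s2]] := coassoc X.
pose B1 (t : U2) (b : U) : C^o := dual2 phi psi t * chi b.
pose B2 (a : U) (t : U2) : C^o := phi a * dual2 psi chi t.
have b1 : balanced (@scale_r _ U2) (@scale_l _ U) B1.
  apply: fbalanced => [n c x y|m c x y]; rewrite /B1.
    by rewrite dual2_linear mulrDl; congr (_ + _); rewrite /GRing.scale /= mulrA.
  by rewrite dual_linear mulrDr; congr (_ + _); rewrite /GRing.scale /= mulrCA.
have b2 : balanced (@scale_r _ U) (@scale_l _ U2) B2.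
  apply: fbalanced => [n c x y|m c x y]; rewrite /B2.
    by rewrite dual_linear mulrDl; congr (_ + _); rewrite /GRing.scale /= mulrA.
  by rewrite dual2_linear mulrDr; congr (_ + _); rewrite /GRing.scale /= mulrCA.
have L1 : linear G1 by apply: tens_map_linear => //; exact: coprod_linear.
have L2 : linear G2 by apply: tens_map_linear => //; exact: coprod_linear.
have T1 a b : G1 (ften a b) = ften (coprod a) b.
  by apply: tens_map_ten => //; exact: coprod_linear.
have T2 a b : G2 (ften a b) = ften a (coprod b).
  by apply: tens_map_ten => //; exact: coprod_linear.
have l1 := tlift_linear b1; have l2 := tlift_linear b2.
have e1 t : dual2 (conv phi psi) chi t = tlift B1 (G1 t).
  elim/tens_ind: t => [a b||t u et eu].
  - by rewrite dual2_ten T1 tlift_tensor.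
  - by rewrite (lin0 (dual2_linear _ _)) (lin0 L1) (lin0 l1).
  - by rewrite (linD (dual2_linear _ _)) (linD L1) (linD l1) et eu.
have e2 t : dual2 phi (conv psi chi) t = tlift B2 (G2 t).
  elim/tens_ind: t => [a b||t u et eu].
  - by rewrite dual2_ten T2 tlift_tensor.
  - by rewrite (lin0 (dual2_linear _ _)) (lin0 L2) (lin0 l2).
  - by rewrite (linD (dual2_linear _ _)) (linD L2) (linD l2) et eu.
rewrite e1 e2 s1 s2.
rewrite (big_morph _ (linD l1) (lin0 l1)) (big_morph _ (linD l2) (lin0 l2)).
apply: eq_bigr => p _; rewrite !tlift_tensor // /B1 /B2 !dual2_ten.
by rewrite mulrA.
Qed.

Lemma conv1l : left_id dual_one conv.
Proof.
move=> phi; apply: dualP => X /=; rewrite -{2}[X]counit_coprodl.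
rewrite /dual2 /tlift /fsum.
rewrite (big_morph _ (linD (@dual_linear phi)) (lin0 (@dual_linear phi))).
by apply: eq_bigr => p _; rewrite (linZ _ _ (@dual_linear phi)).
Qed.
Lemma conv1r : right_id dual_one conv.
Proof.
move=> phi; apply: dualP => X /=; rewrite -{2}[X]counit_coprodr.
rewrite /dual2 /tlift /fsum.
rewrite (big_morph _ (linD (@dual_linear phi)) (lin0 (@dual_linear phi))).
by apply: eq_bigr => p _; rewrite (linZ _ _ (@dual_linear phi)) mulrC.
Qed.
Lemma convDl : left_distributive conv +%R.
Proof. by move=> phi phi' psi; apply: dualP => X; exact: dual2Dl. Qed.
Lemma convDr : right_distributive conv +%R.
Proof. by move=> phi phi' psi; apply: dualP => X; exact: dual2Dr. Qed.
Lemma dual_nz : dual_one != 0.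
Proof.
apply/eqP => /(congr1 (fun phi : Uq_dual => phi 1)) /=; rewrite counit1 => /eqP.
by rewrite oner_eq0.
Qed.
HB.instance Definition _ := GRing.Zmodule_isNzRing.Build Uq_dual
  convA conv1l conv1r convDl convDr dual_nz.
Lemma conv_scaleAl c phi psi : c *: (phi * psi) = (c *: phi) * psi.
Proof. by apply: dualP => X; rewrite /= dual2Zl. Qed.
HB.instance Definition _ := GRing.Lmodule_isLalgebra.Build C Uq_dual conv_scaleAl.
Lemma conv_scaleAr c phi psi : c *: (phi * psi) = phi * (c *: psi).
Proof. by apply: dualP => X; rewrite /= dual2Zr. Qed.
HB.instance Definition _ := GRing.Lalgebra_isAlgebra.Build C Uq_dual conv_scaleAr.
End Coprod.


Section Generated.
Variables (C : fieldType) (A : algType C) (G : A -> Prop).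
Inductive alg_gen : A -> Prop :=
  | ag_gen a : G a -> alg_gen a
  | ag_one : alg_gen 1
  | ag_lin c a b : alg_gen a -> alg_gen b -> alg_gen (c *: a + b)
  | ag_mul a b : alg_gen a -> alg_gen b -> alg_gen (a * b).
Lemma alg_gen_closed : subalg_closed (fun a => `[< alg_gen a >]).
Proof.
split; first exact/asboolP/ag_one.
- by move=> c a b /asboolP ha /asboolP hb; apply/asboolP/ag_lin.
- by move=> a b /asboolP ha /asboolP hb; apply/asboolP/ag_mul.
Qed.
End Generated.

Section Oq.
Variables (C : fieldType) (g : simple_type) (q : C).
Local Notation I := 'I_(rank g).
Local Notation U := (Uq g q).
Local Notation D := (Uq_dual g q).

Record is_rep n (rho : U -> 'M[C]_n) : Prop := IsRep {
  rep_linear : linear rho;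
  rep1 : rho 1 = 1%:M;
  repM : forall X Y, rho (X * Y) = rho X *m rho Y
}.

(* K_i acts on the weight space of mu = sum_i mu_i varpi_i by
   q^(mu, alpha_i) = q_i^(mu_i). *)
Definition weight_vector n (rho : U -> 'M[C]_n) (mu : I -> int) (v : 'cV[C]_n) : Prop :=
  forall i, rho (gK q i) *m v = (qi q i ^ mu i) *: v.

Definition type1 n (rho : U -> 'M[C]_n) : Prop :=
  exists2 P : 'M[C]_n, P \in unitmx &
    exists mu : 'I_n -> I -> int, forall j, weight_vector rho (mu j) (col j P).

(* Coordinate functions c^V_{f,v} of type-1 modules V, with V = C^n. *)
Definition is_coef (phi : D) : Prop :=
  exists n (rho : U -> 'M[C]_n) (f : 'rV[C]_n) (v : 'cV[C]_n),
    [/\ is_rep rho, type1 rho & forall X, phi X = (f *m rho X *m v) 0 0].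

(* Coordinate functions span a subspace stable under coproduct and antipode
   (dual modules are type 1), so the algebra they generate is the Hopf
   subalgebra they generate. *)
Definition Oq_pred : {pred D} := fun phi => `[< alg_gen is_coef phi >].
HB.instance Definition _ := GRing.isSubalgClosed.Build C D Oq_pred
  (alg_gen_closed is_coef).

Definition Oq : Type := {phi : D | phi \in Oq_pred}.
HB.instance Definition _ := SubChoice.on Oq.
HB.instance Definition _ := [SubChoice_isSubAlgebra of Oq by <:].


Lemma lact_subproof (X : U) (phi : D) : linear (fun Y : U => phi (Y * X) : C^o).
Proof. by move=> c Y Z; rewrite mulrDl -scalerAl dual_linear. Qed.
(* X |> c^V_{f,v} = c^V_{f,Xv} reads (X |> phi)(Y) = phi(YX). *)
Definition lact_dual (X : U) (phi : D) : D := Dual (lact_subproof X phi).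

Definition invariant_under (L : U -> Prop) (phi : D) : Prop :=
  forall X, L X -> lact_dual X phi = counit X *: phi.

Variable x : I.

(* Generators of U_q(l_S) and U_q(l_S^s), S being all indices but x. *)
Definition levi_gen (X : U) : Prop :=
  (exists i, X = gK q i \/ X = gKinv q i) \/
  (exists2 s, s != x & X = gE q s \/ X = gF q s).
Definition levis_gen (X : U) : Prop :=
  exists2 s, s != x & [\/ X = gK q s, X = gKinv q s, X = gE q s | X = gF q s].
Definition levi : U -> Prop := alg_gen levi_gen.
Definition levis : U -> Prop := alg_gen levis_gen.

Lemma lact_dual_mul X Y phi : lact_dual (X * Y) phi = lact_dual X (lact_dual Y phi).
Proof. by apply: dualP => Z /=; rewrite mulrA. Qed.
Lemma lact_dual_lin X c phi psi :
  lact_dual X (c *: phi + psi) = c *: lact_dual X phi + lact_dual X psi.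
Proof. exact: dualP. Qed.
Lemma lact_dual_linl c X Y phi :
  lact_dual (c *: X + Y) phi = c *: lact_dual X phi + lact_dual Y phi.
Proof. by apply: dualP => Z /=; rewrite mulrDr -scalerAr dual_linear. Qed.
Lemma lact_dual1 phi : lact_dual 1 phi = phi.
Proof. by apply: dualP => Z /=; rewrite mulr1. Qed.

Lemma invariant_gen (G : U -> Prop) phi :
  invariant_under G phi -> invariant_under (alg_gen G) phi.
Proof.
move=> h X; elim=> {X} [X|{h}|c X Y _ hX _ hY|X Y _ hX _ hY]; first exact: h.
- by rewrite lact_dual1 counit1 scale1r.
- by rewrite lact_dual_linl hX hY (counit_linear c X Y) scalerDl scalerA.
- rewrite lact_dual_mul hY counitM -[counit Y *: phi]addr0 lact_dual_lin hX.
  have -> : lact_dual X (0 : D) = 0 by exact: dualP.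
  by rewrite addr0 scalerA mulrC.
Qed.

Lemma dual2_act phi psi a b (t : Uq2 g q) :
  dual2 phi psi (t * ten a b) = dual2 (lact_dual a phi) (lact_dual b psi) t.
Proof.
rewrite -[t * _]/(tens_mul t _).
have L1 := dual2_linear phi psi; have L2 := dual2_linear (lact_dual a phi) (lact_dual b psi).
elim/tens_ind: t => [c d||t u et eu].
- by rewrite tens_mul_ten !dual2_ten.
- by rewrite tens_mul0l (lin0 L1) (lin0 L2).
- by rewrite tens_mulDl (linD L1) (linD L2) et eu.
Qed.

Lemma lactE i phi psi : lact_dual (gE q i) (phi * psi) =
  lact_dual (gE q i) phi * lact_dual (gK q i) psi + phi * lact_dual (gE q i) psi.
Proof.
apply: dualP => Y; rewrite [LHS]/= coprodM coprodE mulrDr (linD (dual2_linear _ _)).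
by congr (_ + _); rewrite dual2_act ?lact_dual1.
Qed.
Lemma lactF i phi psi : lact_dual (gF q i) (phi * psi) =
  lact_dual (gF q i) phi * psi + lact_dual (gKinv q i) phi * lact_dual (gF q i) psi.
Proof.
apply: dualP => Y; rewrite [LHS]/= coprodM coprodF mulrDr (linD (dual2_linear _ _)).
by congr (_ + _); rewrite dual2_act ?lact_dual1.
Qed.
Lemma lactK i phi psi : lact_dual (gK q i) (phi * psi) =
  lact_dual (gK q i) phi * lact_dual (gK q i) psi.
Proof. by apply: dualP => Y; rewrite [LHS]/= coprodM coprodK dual2_act. Qed.
Lemma lactKinv i phi psi : lact_dual (gKinv q i) (phi * psi) =
  lact_dual (gKinv q i) phi * lact_dual (gKinv q i) psi.
Proof. by apply: dualP => Y; rewrite [LHS]/= coprodM coprodKinv dual2_act. Qed.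

Lemma invariant1 (L : U -> Prop) : invariant_under L 1.
Proof. by move=> X _; apply: dualP => Y /=; rewrite counitM mulrC. Qed.
Lemma invariant_lin (L : U -> Prop) c phi psi :
  invariant_under L phi -> invariant_under L psi -> invariant_under L (c *: phi + psi).
Proof.
move=> h1 h2 X LX; rewrite lact_dual_lin h1 // h2 // scalerDr.
by rewrite !scalerA mulrC.
Qed.

Lemma levi_invM phi psi :
  invariant_under levi phi -> invariant_under levi psi -> invariant_under levi (phi * psi).
Proof.
move=> h1 h2; apply: invariant_gen => X hX.
have iK i : levi (gK q i) by apply: ag_gen; left; exists i; left.
have iV i : levi (gKinv q i) by apply: ag_gen; left; exists i; right.
case: hX => [[i [->|->]]|[s sx [->|->]]].
- by rewrite lactK h1 // h2 // counitK !scale1r.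
- by rewrite lactKinv h1 // h2 // counitKinv !scale1r.
- have hE : levi (gE q s) by apply: ag_gen; right; exists s => //; left.
  by rewrite lactE h1 // !h2 // counitE !scale0r mul0r mulr0 addr0.
- have hF : levi (gF q s) by apply: ag_gen; right; exists s => //; right.
  by rewrite lactF (h1 (gF q s)) // (h2 (gF q s)) // counitF !scale0r mul0r mulr0 addr0.
Qed.

Lemma levis_invM phi psi :
  invariant_under levis phi -> invariant_under levis psi -> invariant_under levis (phi * psi).
Proof.
move=> h1 h2; apply: invariant_gen => X [s sx hX].
have hL Y : levis_gen Y -> levis Y by exact: ag_gen.
case: hX => ->.
- have hK : levis (gK q s) by apply: hL; exists s => //; exact: Or41.
  by rewrite lactK h1 // h2 // counitK !scale1r.
- have hV : levis (gKinv q s) by apply: hL; exists s => //; exact: Or42.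
  by rewrite lactKinv h1 // h2 // counitKinv !scale1r.
- have hE : levis (gE q s) by apply: hL; exists s => //; exact: Or43.
  by rewrite lactE h1 // (h2 (gE q s)) // counitE !scale0r mul0r mulr0 addr0.
- have hF : levis (gF q s) by apply: hL; exists s => //; exact: Or44.
  by rewrite lactF (h1 (gF q s)) // (h2 (gF q s)) // counitF !scale0r mul0r mulr0 addr0.
Qed.

Definition flag_pred : {pred Oq} := fun a => `[< invariant_under levi (val a) >].
Definition phs_pred : {pred Oq} := fun a => `[< invariant_under levis (val a) >].
Lemma flag_closed : subalg_closed flag_pred.
Proof.
split; first exact/asboolP/invariant1.
- move=> c a b /asboolP ha /asboolP hb; apply/asboolP; exact: invariant_lin.
- move=> a b /asboolP ha /asboolP hb; apply/asboolP; exact: levi_invM.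
Qed.
Lemma phs_closed : subalg_closed phs_pred.
Proof.
split; first exact/asboolP/invariant1.
- move=> c a b /asboolP ha /asboolP hb; apply/asboolP; exact: invariant_lin.
- move=> a b /asboolP ha /asboolP hb; apply/asboolP; exact: levis_invM.
Qed.
HB.instance Definition _ := GRing.isSubalgClosed.Build C Oq flag_pred flag_closed.
HB.instance Definition _ := GRing.isSubalgClosed.Build C Oq phs_pred phs_closed.

(* Oq_flag = O_q(G/L_S) and Oq_phs = O_q(G/L_S^s). *)
Definition Oq_flag : Type := {a : Oq | a \in flag_pred}.
HB.instance Definition _ := SubChoice.on Oq_flag.
HB.instance Definition _ := [SubChoice_isSubAlgebra of Oq_flag by <:].

Definition Oq_phs : Type := {a : Oq | a \in phs_pred}.
HB.instance Definition _ := SubChoice.on Oq_phs.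
HB.instance Definition _ := [SubChoice_isSubAlgebra of Oq_phs by <:].

Lemma flag_sub_phs (b : Oq_flag) : val b \in phs_pred.
Proof.
apply/asboolP; have /asboolP h := valP b.
apply: invariant_gen => X [s sx hX]; apply: h; apply: ag_gen.
case: hX => ->.
- by left; exists s; left.
- by left; exists s; right.
- by right; exists s => //; left.
- by right; exists s => //; right.
Qed.
Definition flag_incl (b : Oq_flag) : Oq_phs := Sub (val b) (flag_sub_phs b).

Lemma flag_incl_lin : linear flag_incl.
Proof. by move=> c a b; apply: val_inj. Qed.
Lemma flag_inclM : {morph flag_incl : a b / a * b}.
Proof. by move=> a b; apply: val_inj. Qed.
Lemma flag_incl1 : flag_incl 1 = 1.
Proof. exact: val_inj. Qed.
End Oq.


(* Scalars act through the algebra: C-bilinearity of both actions makes the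
   bimodule C-central. *)
Record bimodule (C : fieldType) (B : algType C) := Bimodule {
  bimod_sort :> lmodType C;
  lact : B -> bimod_sort -> bimod_sort;
  ract : bimod_sort -> B -> bimod_sort;
  lact_linl : forall m, linear (lact^~ m);
  lact_linr : forall b, linear (lact b);
  ract_linl : forall b, linear (ract^~ b);
  ract_linr : forall m, linear (ract m);
  lact1 : forall m, lact 1 m = m;
  lactM : forall a b m, lact (a * b) m = lact a (lact b m);
  ract1 : forall m, ract m 1 = m;
  ractM : forall m a b, ract m (a * b) = ract (ract m a) b;
  lractA : forall a m b, ract (lact a m) b = lact a (ract m b)
}.

Notation btens M N := (tens (@ract _ _ M) (@lact _ _ N)).
Notation bten M N m n := (tensor (@ract _ _ M) (@lact _ _ N) m n).

Section BimoduleTensor.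
Variables (C : fieldType) (B : algType C) (M N : bimodule B).

Definition btens_lact (b : B) (t : btens M N) : btens M N :=
  tlift (fun m n => bten M N (lact b m) n) t.
Definition btens_ract (t : btens M N) (b : B) : btens M N :=
  tlift (fun m n => bten M N m (ract n b)) t.

Let T := tensor_balanced (@ract _ _ M) (@lact _ _ N).

Lemma btens_lact_bal b :
  balanced (@ract _ _ M) (@lact _ _ N) (fun m n => bten M N (lact b m) n).
Proof.
case: T => T1 T2 T3; split=> [n c x y|m c x y|m s n].
- by rewrite lact_linr T1.
- by rewrite T2.
- by rewrite -T3 lractA.
Qed.
Lemma btens_ract_bal b :
  balanced (@ract _ _ M) (@lact _ _ N) (fun m n => bten M N m (ract n b)).
Proof.
case: T => T1 T2 T3; split=> [n c x y|m c x y|m s n].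
- by rewrite T1.
- by rewrite ract_linl T2.
- by rewrite T3 lractA.
Qed.
Lemma btens_lact_ten b m n : btens_lact b (bten M N m n) = bten M N (lact b m) n.
Proof. exact: tlift_tensor (btens_lact_bal b). Qed.
Lemma btens_ract_ten m n b : btens_ract (bten M N m n) b = bten M N m (ract n b).
Proof. exact: tlift_tensor (btens_ract_bal b). Qed.
Lemma btens_lact_linr b : linear (btens_lact b).
Proof. exact: tlift_linear (btens_lact_bal b). Qed.
Lemma btens_ract_linl b : linear (btens_ract^~ b).
Proof. exact: tlift_linear (btens_ract_bal b). Qed.
Lemma btens_lact_linl t : linear (btens_lact^~ t).
Proof.
move=> c a b; rewrite /btens_lact /tlift /fsum scaler_sumr -big_split /=.
by apply: eq_bigr => p _; rewrite lact_linl; case: T => ->.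
Qed.
Lemma btens_ract_linr t : linear (btens_ract t).
Proof.
move=> c a b; rewrite /btens_ract /tlift /fsum scaler_sumr -big_split /=.
by apply: eq_bigr => p _; rewrite ract_linr; case: T => _ ->.
Qed.

Lemma btens_ext (T' : lmodType C) (f h : btens M N -> T') : linear f -> linear h ->
  (forall m n, f (bten M N m n) = h (bten M N m n)) -> forall t, f t = h t.
Proof.
move=> lf lh e t; elim/tens_ind: t => [m n||t u et eu]; first exact: e.
- by rewrite (lin0 lf) (lin0 lh).
- by rewrite (linD lf) (linD lh) et eu.
Qed.

Lemma comp_linear (M1 M2 M3 : lmodType C) (f : M2 -> M3) (h : M1 -> M2) :
  linear f -> linear h -> linear (fun x => f (h x)).
Proof. by move=> lf lh c x y; rewrite lh lf. Qed.

Lemma btens_lact1 t : btens_lact 1 t = t.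
Proof.
move: t; apply: btens_ext => // [|m n]; first exact: btens_lact_linr.
by rewrite btens_lact_ten lact1.
Qed.
Lemma btens_ract1 t : btens_ract t 1 = t.
Proof.
move: t; apply: btens_ext => // [|m n]; first exact: btens_ract_linl.
by rewrite btens_ract_ten ract1.
Qed.
Lemma btens_lactM a b t : btens_lact (a * b) t = btens_lact a (btens_lact b t).
Proof.
move: t; apply: btens_ext => [||m n]; first exact: btens_lact_linr.
  by apply: comp_linear; exact: btens_lact_linr.
by rewrite !btens_lact_ten lactM.
Qed.
Lemma btens_ractM t a b : btens_ract t (a * b) = btens_ract (btens_ract t a) b.
Proof.
move: t; apply: btens_ext => [||m n]; first exact: btens_ract_linl.
  by apply: (comp_linear (btens_ract_linl b)); exact: btens_ract_linl.
by rewrite !btens_ract_ten ractM.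
Qed.
Lemma btens_lractA a t b : btens_ract (btens_lact a t) b = btens_lact a (btens_ract t b).
Proof.
move: t; apply: btens_ext => [||m n].
- by apply: (comp_linear (btens_ract_linl b)); exact: btens_lact_linr.
- by apply: comp_linear; [exact: btens_lact_linr|exact: btens_ract_linl].
by rewrite btens_lact_ten !btens_ract_ten btens_lact_ten.
Qed.

Definition btens_bimod : bimodule B := Bimodule btens_lact_linl btens_lact_linr
  btens_ract_linl btens_ract_linr btens_lact1 btens_lactM btens_ract1 btens_ractM
  btens_lractA.
End BimoduleTensor.

Record fodc (C : fieldType) (B : algType C) := Fodc {
  fodc_bimod :> bimodule B;
  fd : B -> fodc_bimod;
  fd_linear : linear fd;
  fd_leibniz : forall a b, fd (a * b) = ract (fd a) b + lact a (fd b);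
  fd_gen : forall w, exists s : seq (B * B), w = \sum_(p <- s) lact p.1 (fd p.2)
}.

(* fd_gen makes the image of iota the sub-calculus generated by the d b. *)
Definition is_restriction (C : fieldType) (A B : algType C) (incl : B -> A)
    (Gam : fodc A) (Om : fodc B) : Prop :=
  exists iota : Om -> Gam,
    [/\ linear iota, injective iota,
        forall b w, iota (lact b w) = lact (incl b) (iota w),
        forall w b, iota (ract w b) = ract (iota w) (incl b)
      & forall b, iota (fd Om b) = fd Gam (incl b)].

Definition bimodule_map (C : fieldType) (B : algType C) (M N : bimodule B)
    (f : M -> N) : Prop :=
  [/\ linear f, forall b m, f (lact b m) = lact b (f m)
    & forall m b, f (ract m b) = ract (f m) b].

Section Connection.
Variables (C : fieldType) (B : algType C) (Om : fodc B) (E : bimodule B).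

Definition connection (nabla : E -> btens_bimod Om E) : Prop :=
  linear nabla /\
  forall b e, nabla (lact b e) = bten Om E (fd Om b) e + lact b (nabla e).

Definition associated_map (nabla : E -> btens_bimod Om E)
    (sigma : btens_bimod E Om -> btens_bimod Om E) : Prop :=
  bimodule_map sigma /\
  forall e b, sigma (bten E Om e (fd Om b)) = nabla (ract e b) - ract (nabla e) b.
End Connection.

Section Covariance.
Variables (C : fieldType) (g : simple_type) (q : C).
Local Notation U := (Uq g q).
Local Notation H := (Oq g q).

Definition subspace (M : lmodType C) (W : M -> Prop) : Prop :=
  W 0 /\ forall c m n, W m -> W n -> W (c *: m + n).

(* The left coaction m |-> m_(-1) (x) m_(0) induced by the coproduct of O_q(G)
   on a module M of functionals on U_q(g), j being the embedding:
   it is characterised by m(XY) = m_(-1)(X) m_(0)(Y). *)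
Definition Oq_coact (M : lmodType C) (j : M -> Uq_dual g q) (m : M) : ftens H M :=
  classical_sets.xget 0 (fun t : ftens H M =>
    forall X Y : U, j m (X * Y) = tlift (fun h m' => (val h : Uq_dual g q) X * j m' Y : C^o) t).

Definition Oq_coprod : H -> ftens H H := Oq_coact val.
Definition Oq_counit (h : H) : C := (val h : Uq_dual g q) 1.

Definition coaction (M : lmodType C) (delta : M -> ftens H M) : Prop :=
  [/\ linear delta,
      forall m, tlift (fun h m' => Oq_counit h *: m') (delta m) = m
    & forall m,
        tlift (fun h m' => ften h (delta m')) (delta m) =
        tlift (fun h m' => tlift (fun h1 h2 => ften h1 (ften h2 m')) (Oq_coprod h))
          (delta m)].

Definition subcomodule (M : lmodType C) (delta : M -> ftens H M) (W : M -> Prop) : Prop :=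
  subspace W /\
  forall m, W m -> exists2 s : seq (H * M),
    (forall p, p \in s -> W p.2) & delta m = \sum_(p <- s) ften p.1 p.2.

(* Smallest subcomodule containing m0. *)
Definition gen_subcomodule (M : lmodType C) (delta : M -> ftens H M) (m0 : M) : M -> Prop :=
  fun m => forall W, subcomodule delta W -> W m0 -> W m.

Section FODC.
Variables (B : algType C) (j : B -> Uq_dual g q) (Om : fodc B).
Local Notation dB := (Oq_coact j).

(* delta (b d b') = b_(1) b'_(1) (x) b_(2) d b'_(2); fd_gen makes delta unique. *)
Definition covariant (delta : Om -> ftens H Om) : Prop :=
  coaction delta /\
  forall b b', delta (lact b (fd Om b')) =
    tlift (fun h c => tlift (fun h' c' => ften (h * h') (lact c (fd Om c'))) (dB b'))
      (dB b).

Definition irreducible (delta : Om -> ftens H Om) : Prop :=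
  (exists w : Om, w != 0) /\
  forall W : Om -> Prop, subcomodule delta W ->
    (forall b w, W w -> W (lact b w)) -> (forall w b, W w -> W (ract w b)) ->
    (forall w, W w -> w = 0) \/ (forall w, W w).

(* Om / B^+ Om is finite-dimensional; the counit of B is evaluation at 1. *)
Definition fin_dim : Prop :=
  exists n (w : 'I_n -> Om), forall v : Om, exists (c : 'I_n -> C) (s : seq (B * Om)),
    (forall p, p \in s -> j p.1 1 = 0) /\
    v = \sum_i c i *: w i + \sum_(p <- s) lact p.1 p.2.

Definition tens_coact (E : bimodule B) (dOm : Om -> ftens H Om) (dE : E -> ftens H E)
    (t : btens Om E) : ftens H (btens Om E) :=
  tlift (fun w e => tlift (fun h w' => tlift (fun h' e' =>
    ften (h * h') (bten Om E w' e')) (dE e)) (dOm w)) t.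

Definition covariant_connection (E : bimodule B) (dOm : Om -> ftens H Om)
    (dE : E -> ftens H E) (nabla : E -> btens_bimod Om E) : Prop :=
  connection nabla /\
  forall e, tens_coact dOm dE (nabla e) = tlift (fun h e' => ften h (nabla e')) (dE e).
End FODC.
End Covariance.

Definition zgrading (C : fieldType) (M : lmodType C) (Gr : int -> M -> Prop) : Prop :=
  [/\ forall k, subspace (Gr k),
      forall m, exists (s : seq int) (w : int -> M),
        (forall k, Gr k (w k)) /\ m = \sum_(k <- s) w k
    & forall (s : seq int) (w : int -> M), uniq s -> (forall k, Gr k (w k)) ->
        \sum_(k <- s) w k = 0 -> forall k, k \in s -> w k = 0].

Section Lines.
Variables (C : fieldType) (g : simple_type) (q : C) (x : 'I_(rank g)).
Local Notation A := (Oq_phs q x).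
Local Notation B := (Oq_flag q x).
Local Notation H := (Oq g q).
Variables (N : nat) (z zb : 'I_N.+1 -> A).

(* line k a: a lies in E_k, the degree k part of the grading of O_q(G/L_S^s)
   with deg z_i = 1 and deg zb_j = -1. The generators z_i, zb_j alone span all
   degrees; B = E_0 is listed so that E_k is visibly a B-bimodule. *)
Inductive line : int -> A -> Prop :=
  | line_flag b : line 0 (flag_incl b)
  | line_z i : line 1 (z i)
  | line_zb i : line (-1) (zb i)
  | line_0 k : line k 0
  | line_lin k c a b : line k a -> line k b -> line k (c *: a + b)
  | line_mul k l a b : line k a -> line l b -> line (k + l) (a * b).

Definition line_pred k : {pred A} := fun a => `[< line k a >].
Lemma line_closed k : submod_closed (line_pred k).
Proof.
split; first exact/asboolP/line_0.
by move=> c a b /asboolP ha /asboolP hb; apply/asboolP/line_lin.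
Qed.
HB.instance Definition _ k := GRing.isSubmodClosed.Build C A (line_pred k) (line_closed k).

Definition rel_line k : Type := {a : A | a \in line_pred k}.
HB.instance Definition _ k := SubChoice.on (rel_line k).
HB.instance Definition _ k := [SubChoice_isSubZmodule of rel_line k by <:].
HB.instance Definition _ k := [SubZmodule_isSubLmodule of rel_line k by <:].

Lemma line_lact_sub k (b : B) (e : rel_line k) : flag_incl b * val e \in line_pred k.
Proof.
have /asboolP he := valP e; apply/asboolP.
by have := line_mul (line_flag b) he; rewrite add0r.
Qed.
Lemma line_ract_sub k (e : rel_line k) (b : B) : val e * flag_incl b \in line_pred k.
Proof.
have /asboolP he := valP e; apply/asboolP.
by have := line_mul he (line_flag b); rewrite addr0.
Qed.
Definition line_lact k b e : rel_line k := Sub (flag_incl b * val e) (line_lact_sub b e).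
Definition line_ract k e b : rel_line k := Sub (val e * flag_incl b) (line_ract_sub e b).

Section LineBimod.
Variable k : int.
Lemma line_lact_linl (m : rel_line k) : linear ((@line_lact k)^~ m).
Proof. by move=> c a b; apply: val_inj; rewrite /= flag_incl_lin mulrDl -scalerAl. Qed.
Lemma line_lact_linr b : linear (@line_lact k b).
Proof. by move=> c m n; apply: val_inj; rewrite /= mulrDr -scalerAr. Qed.
Lemma line_ract_linl b : linear ((@line_ract k)^~ b).
Proof. by move=> c m n; apply: val_inj; rewrite /= mulrDl -scalerAl. Qed.
Lemma line_ract_linr (m : rel_line k) : linear (line_ract m).
Proof. by move=> c a b; apply: val_inj; rewrite /= flag_incl_lin mulrDr -scalerAr. Qed.
Lemma line_lact1 (m : rel_line k) : line_lact 1 m = m.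
Proof. by apply: val_inj; rewrite /= flag_incl1 mul1r. Qed.
Lemma line_lactM a b (m : rel_line k) : line_lact (a * b) m = line_lact a (line_lact b m).
Proof. by apply: val_inj; rewrite /= flag_inclM mulrA. Qed.
Lemma line_ract1 (m : rel_line k) : line_ract m 1 = m.
Proof. by apply: val_inj; rewrite /= flag_incl1 mulr1. Qed.
Lemma line_ractM (m : rel_line k) a b : line_ract m (a * b) = line_ract (line_ract m a) b.
Proof. by apply: val_inj; rewrite /= flag_inclM mulrA. Qed.
Lemma line_lractA a (m : rel_line k) b : line_ract (line_lact a m) b = line_lact a (line_ract m b).
Proof. by apply: val_inj; rewrite /= mulrA. Qed.
Definition line_bimod : bimodule B := Bimodule line_lact_linl line_lact_linr
  line_ract_linl line_ract_linr line_lact1 line_lactM line_ract1 line_ractM line_lractA.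
End LineBimod.
End Lines.


Section Roots.
Variable g : simple_type.

(* Roots, as vectors of coordinates in the basis of simple roots: the orbit of
   the simple roots under the simple reflections. *)
Inductive is_root : 'rV[int]_(rank g) -> Prop :=
  | is_root_simple i : is_root (delta_mx 0 i)
  | is_root_refl i b : is_root b -> is_root (b - (\sum_j b 0 j * g i j) *: delta_mx 0 i).

Definition highest_root (t : 'rV[int]_(rank g)) : Prop :=
  is_root t /\ forall b, is_root b -> forall i, b 0 i <= t 0 i.

Definition cominuscule (x : 'I_(rank g)) : Prop :=
  exists t, highest_root t /\ t 0 x = 1.
End Roots.

Section Modules.
Variables (C : fieldType) (g : simple_type) (q : C).
Local Notation I := 'I_(rank g).
Local Notation U := (Uq g q).

Definition fund_weight (x : I) : I -> int := fun i => (i == x)%:Z.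

(* V_lambda = C^(N+1) in a weight basis u_0, ..., u_N whose last vector is a
   highest weight vector. *)
Record irr_module (lambda : I -> int) N (rho : U -> 'M[C]_N.+1) : Prop := IrrModule {
  irr_rep : is_rep rho;
  irr_irr : forall W : 'cV[C]_N.+1 -> Prop, subspace W ->
    (forall X v, W v -> W (rho X *m v)) -> (forall v, W v -> v = 0) \/ (forall v, W v);
  irr_basis : forall j, exists mu, weight_vector rho mu (delta_mx j 0);
  irr_hwE : forall i, rho (gE q i) *m delta_mx ord_max 0 = 0 :> 'cV_N.+1;
  irr_hwK : weight_vector rho lambda (delta_mx ord_max 0)
}.

Definition antipode (S : U -> U) : Prop :=
  linear S /\ forall X,
    tlift (fun a b => S a * b) (coprod X) = (counit X)%:A /\
    tlift (fun a b => a * S b) (coprod X) = (counit X)%:A.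

(* The dual module (X f)(v) = f(S(X) v), in the dual basis. *)
Definition dual_module n (rho rho' : U -> 'M[C]_n) : Prop :=
  is_rep rho' /\ exists2 S, antipode S & forall X, rho' X = (rho (S X))^T.
End Modules.

Section HeckenbergerKolb.
Variables (C : fieldType) (g : simple_type) (q : C) (x : 'I_(rank g)).
Local Notation A := (Oq_phs q x).
Local Notation B := (Oq_flag q x).
Local Notation H := (Oq g q).

Definition phs_val (a : A) : Uq_dual g q := val (val a).
Definition flag_val (b : B) : Uq_dual g q := val (val b).

Variables (N : nat) (z zb : 'I_N.+1 -> A).

Definition line_elt k (e : line_bimod z zb k) : A := val (e : rel_line z zb k).

Definition line_coact k : line_bimod z zb k -> ftens H (line_bimod z zb k) :=
  @Oq_coact C g q (line_bimod z zb k) (fun e => phs_val (line_elt e)).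

(* A right O(U_1)-coaction is a Z-grading; covariance means that
   a (x) a' |-> a d a' is homogeneous for the grading of O_q(G/L_S^s). *)
Definition U1_covariant (Gam : fodc A) : Prop :=
  exists Gr : int -> Gam -> Prop, zgrading Gr /\
    forall k l a b, line z zb k a -> line z zb l b -> Gr (k + l) (lact a (fd Gam b)).

(* (Om, d) is Omega^{(0,1)}_q(G/L_S), as the restriction of the calculus Gam
   over O_q(G/L_S^s); dOm is its coaction. *)
Record HK_calculus (Gam : fodc A) (Om : fodc B) (dOm : Om -> ftens H Om) : Prop :=
  HKCalculus {
  HK_left : exists dGam : Gam -> ftens H Gam, covariant phs_val dGam;
  HK_right : U1_covariant Gam;
  HK_holomorphic : forall i, fd Gam (z i) = 0;
  HK_restriction : is_restriction (@flag_incl C g q x) Gam Om;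
  HK_covariant : covariant flag_val dOm;
  HK_irreducible : irreducible dOm;
  HK_fin_dim : fin_dim flag_val Om
}.

(* nabla is the covariant connection of E_k, i.e. the unique one, sigma its
   bimodule map and sigma' the inverse of sigma. *)
Record dbar_connection (Om : fodc B) (dOm : Om -> ftens H Om) k
    (nabla : line_bimod z zb k -> btens_bimod Om (line_bimod z zb k))
    (sigma : btens_bimod (line_bimod z zb k) Om -> btens_bimod Om (line_bimod z zb k))
    (sigma' : btens_bimod Om (line_bimod z zb k) -> btens_bimod (line_bimod z zb k) Om)
  : Prop := DbarConnection {
  dbar_cov : covariant_connection dOm (@line_coact k) nabla;
  dbar_unique : forall nabla', 
    covariant_connection dOm (@line_coact k) nabla' -> nabla' =1 nabla;
  dbar_sigma : associated_map nabla sigma;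
  dbar_sigmaK : cancel sigma sigma';
  dbar_sigmaVK : cancel sigma' sigma
}.

(* The subcomodules V_k of E_k and V_k^vee of E_{-k}. *)
Definition hol_module (k : nat) : A -> Prop :=
  gen_subcomodule (Oq_coact phs_val) (z ord_max ^+ k).
Definition antihol_module (k : nat) : A -> Prop :=
  gen_subcomodule (Oq_coact phs_val) (zb ord_max ^+ k).

(* An element of O_q(G/L_S^s) that lies in B = E_0, seen in B (it is 0 on
   elements outside B). *)
Definition to_flag (a : A) : B := insubd 0 (val a).
End HeckenbergerKolb.

(* Main.v *)
Require Import Defs.
From mathcomp Require Import all_boot all_order all_algebra.
From mathcomp Require Import boolp reals complex.
Set Implicit Arguments. Unset Strict Implicit. Unset Printing Implicit Defensive.
Import GRing.Theory.
Local Open Scope ring_scope.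
Local Open Scope complex_scope.

(* Everything takes place in the calculus Gam over O_q(G/L_S^s) that restricts
   to Om. If sum_i p_i r_i = 1 with r_i in E_k and p_i in E_{-k}, then
   w (x) e |-> w e embeds Om (x)_B E_k into Gam, because
   w (x) e = sum_i w (e p_i) (x) r_i and each e p_i lies in B.
   The kernel of d in Gam is a subcomodule and a subalgebra, so it contains V_k.
   Hence sum_i d(e p_i) (x) r_i is sent to d e whenever the p_i or the r_i lie
   in V_k, so that it is a covariant connection on E_k, and the only one. In Gam
   the bimodule map sigma becomes e (x) w |-> e w, and the four formulas reduce
   to the Leibniz rule. *)

(** * Linear maps as bare functions *)

Lemma lin_sum (C : pzRingType) (M N : lmodType C) (f : M -> N) (J : Type)
    (s : seq J) (P : pred J) (F : J -> M) :
  linear f -> f (\sum_(j <- s | P j) F j) = \sum_(j <- s | P j) f (F j).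
Proof. by move=> lf; exact: (big_morph f (linD lf) (lin0 lf)). Qed.

Lemma linN (C : pzRingType) (M N : lmodType C) (f : M -> N) :
  linear f -> {morph f : x / - x}.
Proof. by move=> lf x; rewrite -!scaleN1r linZ. Qed.

Lemma linB (C : pzRingType) (M N : lmodType C) (f : M -> N) :
  linear f -> {morph f : x y / x - y}.
Proof. by move=> lf x y; rewrite (linD lf) (linN lf). Qed.

(** * From left coactions of O_q(G) to actions of U_q(g) *)

Section Evaluation.
Variables (C : fieldType) (g : simple_type) (q : C).
Local Notation U := (Uq g q).
Local Notation D := (Uq_dual g q).
Local Notation H := (Oq g q).

Definition oval (h : H) : D := val h.

Lemma oval_lin c h h' X : oval (c *: h + h') X = c * oval h X + oval h' X.
Proof. by []. Qed.

Section OneModule.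
Variable M : lmodType C.

(** Elements of O_q(G) are functionals on U_q(g), so these maps separate tensors ([ev_ext]), and
    they turn a left coaction into a right action of U_q(g). Identities between tensors can thus be
    checked one X at a time. *)
Definition ev (X : U) (t : ftens H M) : M := tlift (fun h m => oval h X *: m) t.

Lemma ev_bal X : balanced (@scale_r _ H) (@scale_l _ M) (fun h m => oval h X *: m).
Proof.
apply: fbalanced => [n c x y|m c x y].
  by rewrite oval_lin scalerDl scalerA.
by rewrite scalerDr !scalerA mulrC.
Qed.

Lemma ev_linear X : linear (ev X).
Proof. exact: tlift_linear (ev_bal X). Qed.

Lemma ev_ten X h m : ev X (ften h m) = oval h X *: m.
Proof. exact: tlift_tensor (ev_bal X). Qed.

Lemma ev_sum X (s : seq (H * M)) :
  ev X (\sum_(p <- s) ften p.1 p.2) = \sum_(p <- s) oval p.1 X *: p.2.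
Proof.
by rewrite (lin_sum _ _ _ (ev_linear X)); apply: eq_bigr => p _; rewrite ev_ten.
Qed.

(* Gaussian elimination on the first factors of a formal sum: when h(X) <> 0
   the first term h (x) m can be replaced by (h / h(X)) (x) ev X t. *)
Lemma ev_subspace (W : M -> Prop) (t : ftens H M) : subspace W ->
  (forall X, W (ev X t)) ->
  exists2 s : seq (H * M), (forall p, p \in s -> W p.2)
    & t = \sum_(p <- s) ften p.1 p.2.
Proof.
case=> W0 WL; rewrite [t]tens_reprE; move: (repr t) => s.
have [n] := ubnP (size s); elim: n s => // n IH [|[h m] s] /= sn hW.
  by exists [::].
have [h0|/existsNP[X hX]] := pselect (forall X, oval h X = 0).
  have -> : h = 0 by apply/val_inj/dualP => X; rewrite -/(oval h) h0.
  rewrite big_cons /= ften0l add0r; apply: IH => // X.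
  by have := hW X; rewrite big_cons (linD (ev_linear X)) /= ev_ten h0 scale0r add0r.
have {}hX : oval h X != 0 by apply/eqP.
set T := \sum_(p <- _) _ in hW *.
pose h' := (oval h X)^-1 *: h.
pose s' := [seq (p.1 - oval p.1 X *: h', p.2) | p <- s].
have TE : T = ften h' (ev X T) + \sum_(p <- s') ften p.1 p.2.
  rewrite /T ev_sum !big_cons /s' big_map /= ftenDr ftenZr -ftenZl scalerA divff //.
  rewrite scale1r -addrA; congr (_ + _).
  have -> : ften h' (\sum_(p <- s) oval p.1 X *: p.2) =
      \sum_(p <- s) ften (oval p.1 X *: h') p.2.
    have lh : linear (fun m : M => ften h' m) by move=> c m1 m2; rewrite ftenDr ftenZr.
    rewrite (lin_sum _ _ _ lh).
    by apply: eq_bigr => p _; rewrite ftenZr -ftenZl.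
  rewrite -big_split /=; apply: eq_bigr => p _.
  by rewrite -ftenDl addrC subrK.
have [|Y|s'' s''W s''E] := IH s'.
- by rewrite size_map; rewrite ltnS in sn.
- have -> : ev Y (\sum_(p <- s') ften p.1 p.2) = - oval h' Y *: ev X T + ev Y T.
    by rewrite {2}TE (linD (ev_linear Y)) ev_ten scaleNr addKr.
  exact: WL.
exists ((h', ev X T) :: s'') => [p|].
  by rewrite inE => /predU1P[->|/s''W //]; exact: hW.
by rewrite big_cons -s''E -TE.
Qed.

(** [ev_subspace] for the zero subspace: the difference has a representative whose second factors
    all vanish. *)
Lemma ev_ext (t u : ftens H M) : (forall X, ev X t = ev X u) -> t = u.
Proof.
move=> tu; apply/eqP; rewrite -subr_eq0; apply/eqP.
have [|X|s s0 ->] := @ev_subspace (fun m => m = 0) (t - u).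
- by split=> // c m n -> ->; rewrite scaler0 addr0.
- by rewrite (linB (ev_linear X)) tu subrr.
by rewrite big_seq big1 // => p /s0 ->; rewrite ften0r.
Qed.
End OneModule.

Lemma ovalM (h h' : H) X :
  oval (h * h') X = \sum_(p <- repr (coprod X)) oval h p.1 * oval h' p.2.
Proof. by []. Qed.

(** The product of O_q(G) is convolution, so evaluating h h' at X distributes X_(1) and X_(2) over
    the two tensors. This handles every diagonal coaction below. *)
Lemma ev_tlift2 (M N T : lmodType C) (b : M -> N -> T) X (t : ftens H M) (u : ftens H N) :
  (forall n, linear (b^~ n)) -> (forall m, linear (b m)) ->
  ev X (tlift (fun h m => tlift (fun h' n => ften (h * h') (b m n)) u) t) =
  \sum_(p <- repr (coprod X)) b (ev p.1 t) (ev p.2 u).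
Proof.
move=> bl br; rewrite {1}/tlift /fsum (lin_sum _ _ _ (ev_linear X)).
under eq_bigr => a _.
  rewrite /tlift /fsum (lin_sum _ _ _ (ev_linear X)).
  under eq_bigr => c _ do rewrite ev_ten ovalM scaler_suml.
  rewrite exchange_big /=; over.
rewrite exchange_big /=; apply: eq_bigr => p _.
rewrite /ev /tlift /fsum (lin_sum _ _ _ (bl _)); apply: eq_bigr => a _.
rewrite (linZ _ _ (bl _)) (lin_sum _ _ _ (br _)) scaler_sumr; apply: eq_bigr => c _.
by rewrite (linZ _ _ (br _)) scalerA.
Qed.

Lemma rtrans_subproof (X : U) (phi : D) : linear (fun Y : U => phi (X * Y) : C^o).
Proof. by move=> c Y Z; rewrite mulrDr -scalerAr dual_linear. Qed.
(** Transpose of left multiplication by X: the right action of U_q(g) on its dual that the left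
    coaction induces. It commutes with [lact_dual], which defines invariance. *)
Definition rtrans (X : U) (phi : D) : D := Dual (rtrans_subproof X phi).

Lemma rtrans_linear X : linear (rtrans X).
Proof. by move=> c phi psi; exact: dualP. Qed.

Lemma rtrans_linearl c X Y phi :
  rtrans (c *: X + Y) phi = c *: rtrans X phi + rtrans Y phi.
Proof. by apply: dualP => Z /=; rewrite mulrDl -scalerAl dual_linear. Qed.

Lemma dual2_rtrans phi psi a b (t : Uq2 g q) :
  dual2 phi psi (ten a b * t) = dual2 (rtrans a phi) (rtrans b psi) t.
Proof.
rewrite -[_ * t]/(tens_mul _ t).
have L1 := dual2_linear phi psi; have L2 := dual2_linear (rtrans a phi) (rtrans b psi).
elim/tens_ind: t => [c d||t u et eu].
- by rewrite tens_mul_ten !dual2_ten.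
- by rewrite tens_mul0r (lin0 L1) (lin0 L2).
- by rewrite tens_mulDr (linD L1) (linD L2) et eu.
Qed.

Lemma dual_sumE (J : Type) (s : seq J) (F : J -> D) X :
  (\sum_(j <- s) F j) X = \sum_(j <- s) F j X.
Proof. by elim: s => [|j s IH]; rewrite ?big_nil // !big_cons -IH. Qed.

(** The coproduct is multiplicative, so X_(1) and X_(2) act on separate convolution factors. *)
Lemma rtransM X phi psi :
  rtrans X (phi * psi) = \sum_(p <- repr (coprod X)) rtrans p.1 phi * rtrans p.2 psi.
Proof.
apply: dualP => Y; rewrite dual_sumE.
rewrite -[LHS]/(dual2 phi psi (coprod (X * Y))) coprodM.
rewrite {1}[coprod X]tens_reprE mulr_suml (lin_sum _ _ _ (dual2_linear phi psi)).
by apply: eq_bigr => p _; exact: dual2_rtrans.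
Qed.

Lemma rtrans1 X : rtrans X 1 = counit X *: 1.
Proof. by apply: dualP => Y; exact: counitM. Qed.

(** Coassociativity in Sweedler form, for the chosen representatives of the coproducts. Trilinearity
    makes both sides functions of the two iterated coproducts, which [coassoc] expands over a common
    family of triples. *)
Lemma coprod_coassoc (V : lmodType C) (T : U -> U -> U -> V) X :
  (forall b c, linear (fun a => T a b c)) -> (forall a c, linear (fun b => T a b c)) ->
  (forall a b, linear (T a b)) ->
  \sum_(p <- repr (coprod X)) \sum_(r <- repr (coprod p.1)) T r.1 r.2 p.2 =
  \sum_(p <- repr (coprod X)) \sum_(r <- repr (coprod p.2)) T p.1 r.1 r.2.
Proof.
move=> Ta Tb Tc; have [s [s1 s2]] := coassoc X.
pose B1 (t : Uq2 g q) (c : U) := tlift (fun a b => T a b c) t.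
pose B2 (a : U) (t : Uq2 g q) := tlift (T a) t.
have balT c : balanced (@scale_r _ U) (@scale_l _ U) (fun a b => T a b c).
  by apply: fbalanced => [b|a]; [exact: Ta|exact: Tb].
have balT' a : balanced (@scale_r _ U) (@scale_l _ U) (T a).
  by apply: fbalanced => [c|b]; [exact: Tb|exact: Tc].
have b1 : balanced (@scale_r _ (Uq2 g q)) (@scale_l _ U) B1.
  apply: fbalanced => [n|m]; first exact: tlift_linear (balT n).
  move=> c x y; rewrite /B1 /tlift /fsum scaler_sumr -big_split /=.
  by apply: eq_bigr => p _; rewrite Tc.
have b2 : balanced (@scale_r _ U) (@scale_l _ (Uq2 g q)) B2.
  apply: fbalanced => [n|m]; last exact: tlift_linear (balT' m).
  move=> c x y; rewrite /B2 /tlift /fsum scaler_sumr -big_split /=.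
  by apply: eq_bigr => p _; rewrite Ta.
have L1 := tens_map_linear (@coprod_linear C g q) (@id_linear C U).
have L2 := tens_map_linear (@id_linear C U) (@coprod_linear C g q).
have T1 a b : tens_map (@coprod C g q) id (ften a b) = ften (coprod a) b.
  by apply: tens_map_ten => //; exact: coprod_linear.
have T2 a b : tens_map id (@coprod C g q) (ften a b) = ften a (coprod b).
  by apply: tens_map_ten => //; exact: coprod_linear.
have -> : \sum_(p <- repr (coprod X)) \sum_(r <- repr (coprod p.1)) T r.1 r.2 p.2 =
    tlift B1 (tens_map (@coprod C g q) id (coprod X)).
  rewrite {2}[coprod X]tens_reprE (lin_sum _ _ _ L1) (lin_sum _ _ _ (tlift_linear b1)).
  by apply: eq_bigr => p _; rewrite T1 tlift_tensor.
have -> : \sum_(p <- repr (coprod X)) \sum_(r <- repr (coprod p.2)) T p.1 r.1 r.2 =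
    tlift B2 (tens_map id (@coprod C g q) (coprod X)).
  rewrite {2}[coprod X]tens_reprE (lin_sum _ _ _ L2) (lin_sum _ _ _ (tlift_linear b2)).
  by apply: eq_bigr => p _; rewrite T2 tlift_tensor.
rewrite s1 s2 (lin_sum _ _ _ (tlift_linear b1)) (lin_sum _ _ _ (tlift_linear b2)).
by apply: eq_bigr => p _; rewrite !tlift_tensor // /B1 /B2 !tlift_tensor.
Qed.

Lemma coef_subproof n (rho : U -> 'M[C]_n) (f : 'rV[C]_n) (v : 'cV[C]_n) :
  is_rep rho -> linear (fun X => (f *m rho X *m v) 0 0 : C^o).
Proof.
move=> r c X Y; rewrite (rep_linear r) mulmxDr mulmxDl -scalemxAr -scalemxAl.
by rewrite !mxE.
Qed.
Definition coef n (rho : U -> 'M[C]_n) f v (r : is_rep rho) : D :=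
  Dual (coef_subproof f v r).

Lemma coef_Oq n (rho : U -> 'M[C]_n) f v (r : is_rep rho) :
  type1 rho -> coef f v r \in @Oq_pred C g q.
Proof. by move=> t; apply/asboolP/ag_gen; exists n, rho, f, v. Qed.

(** Induction on the way h is generated. For a coordinate function, the coproduct comes from
    inserting the identity matrix between rho(X) and rho(Y). *)
Lemma Oq_coprod_ex (h : H) : exists s : seq (H * H), forall X Y,
  oval h (X * Y) = \sum_(p <- s) oval p.1 X * oval p.2 Y.
Proof.
suff: forall phi : D, alg_gen (@is_coef C g q) phi -> exists s : seq (H * H), forall X Y,
    phi (X * Y) = \sum_(p <- s) oval p.1 X * oval p.2 Y.
  by apply; exact/asboolP/(valP h).
move=> phi; elim => {h} [h [n [rho [f [v [r t hE]]]]]||c h h' _ [s sE] _ [s' sE']|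
    h h' _ [s sE] _ [s' sE']].
- pose l k : H := Sub (coef f (delta_mx k 0) r) (coef_Oq _ _ r t).
  pose l' k : H := Sub (coef (delta_mx 0 k) v r) (coef_Oq _ _ r t).
  exists [seq (l k, l' k) | k <- index_enum 'I_n] => X Y; rewrite big_map hE (repM r).
  rewrite mulmxA -mulmxA mxE; apply: eq_bigr => k _; rewrite /oval /l /l' /=.
  by rewrite -!colE -(mulmxA 'e_k) -rowE [col _ _ _ _]mxE [row _ _ _ _]mxE. 
- by exists [:: (1, 1)] => X Y; rewrite big_seq1; exact: counitM.
- exists ([seq (c *: p.1, p.2) | p <- s] ++ s') => X Y.
  rewrite big_cat big_map /= -sE' -[LHS]/(c * h (X * Y) + h' (X * Y)) sE mulr_sumr.
  by congr (_ + _); apply: eq_bigr => p _; rewrite mulrA.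
- exists [seq (p.1 * r.1, p.2 * r.2) | p <- s, r <- s'] => X Y.
  (* A coproduct read this way computes translations, which reduces the product case to
     [rtransM]. *)
  have rtE (k : D) (l : seq (H * H)) Z :
      (forall X Y, k (X * Y) = \sum_(p <- l) oval p.1 X * oval p.2 Y) ->
      rtrans Z k = \sum_(p <- l) oval p.1 Z *: oval p.2.
    by move=> kE; apply: dualP => W; rewrite dual_sumE /= kE.
  rewrite -[LHS]/(rtrans X (h * h') Y) rtransM dual_sumE big_allpairs_dep.
  transitivity (\sum_(p <- s) \sum_(a <- repr (coprod X)) \sum_(r <- s')
      oval p.1 a.1 * oval r.1 a.2 * oval (p.2 * r.2) Y); last first.
    apply: eq_bigr => p _; rewrite exchange_big /=; apply: eq_bigr => r _.
    by rewrite -mulr_suml.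
  rewrite [RHS]exchange_big; apply: eq_bigr => a _.
  rewrite (rtE _ _ _ sE) (rtE _ _ _ sE') mulr_suml dual_sumE; apply: eq_bigr => p _.
  rewrite mulr_sumr dual_sumE; apply: eq_bigr => r _.
  by rewrite -scalerAl -scalerAr scalerA.
Qed.

Section Comodule.
Variables (M : lmodType C) (j : M -> D) (act : U -> M -> M).
Hypotheses (j_linear : linear j) (j_inj : injective j).
Hypotheses (j_Oq : forall m, j m \in @Oq_pred C g q)
  (j_act : forall X m, j (act X m) = rtrans X (j m)).

(** [Oq_coact] only selects a tensor with [xget]; injectivity of [j] gives its values once a tensor
    with the required property is known to exist. *)
Lemma ev_coact X m : ev X (Oq_coact j m) = act X m.
Proof.
rewrite /Oq_coact; case: classical_sets.xgetP => [t -> tE|noe].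
  apply/j_inj/dualP => Y; rewrite j_act /= tE /ev {1}/tlift /fsum.
  by rewrite (lin_sum _ _ _ j_linear) dual_sumE; apply: eq_bigr => p _; rewrite (linZ _ _ j_linear).
(* The case where no tensor qualifies is contradictory, since one can be built from the coproduct of
   [j m]. *)
have [s sE] := Oq_coprod_ex (Sub (j m) (j_Oq m)).
have sev Y (l : seq (H * H)) Z :
    oval (ev Y (\sum_(p <- l) ften p.1 p.2)) Z = \sum_(p <- l) oval p.1 Y * oval p.2 Z.
  rewrite ev_sum /oval raddf_sum dual_sumE.
  by apply: eq_bigr => p _.
(* All values of this tensor are of the form [j (act Y m)], so its second factors can be chosen in
   the image of [j] and lifted to M. *)
have [||s' s'W s'E] := @ev_subspace H (fun h => exists m', j m' = oval h)
    (\sum_(p <- s) ften p.1 p.2).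
- split=> [|c h h' [k kE] [k' kE']]; first by exists 0; rewrite (lin0 j_linear).
  by exists (c *: k + k'); rewrite j_linear kE kE'.
- by move=> Y; exists (act Y m); apply: dualP => Z; rewrite sev -sE j_act.
pose pre (h : H) := classical_sets.xget 0 (fun m' => j m' = oval h).
have preE p : p \in s' -> j (pre p.2) = oval p.2.
  move/s'W => [k kE]; rewrite /pre; case: classical_sets.xgetP => [? -> //|].
  by move/(_ k); rewrite kE.
case: (noe (\sum_(p <- s') ften p.1 (pre p.2))) => Y Z.
have b : balanced (@scale_r _ H) (@scale_l _ M) (fun h m' => oval h Y * j m' Z : C^o).
  apply: fbalanced => [n c a b|a c m1 m2].
    by rewrite oval_lin mulrDl -mulrA.
  by rewrite j_linear mulrDr; congr (_ + _); exact: mulrCA.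
rewrite (lin_sum _ _ _ (tlift_linear b)).
transitivity (oval (ev Y (\sum_(p <- s) ften p.1 p.2)) Z).
  by rewrite sev -sE.
rewrite s'E sev big_seq [RHS]big_seq; apply: eq_bigr => p /preE ps'.
by rewrite tlift_tensor // ps'.
Qed.

(** The way back from actions to coactions: once all translates of m lie in W, [ev_subspace] puts
    the second factors of the coaction of m into W. *)
Lemma coact_subcomodule (W : M -> Prop) : subspace W ->
  (forall X m, W m -> W (act X m)) -> subcomodule (Oq_coact j) W.
Proof.
move=> Wsub Wact; split=> // m Wm; apply: ev_subspace => // X.
by rewrite ev_coact; exact: Wact.
Qed.
End Comodule.
End Evaluation.

(** * Generation and the Leibniz rule in a first-order calculus *)

Section FodcTheory.
Variables (C : fieldType) (A : algType C) (Gam : fodc A).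

Lemma fodc_ind (P : Gam -> Prop) :
  P 0 -> (forall u v, P u -> P v -> P (u + v)) ->
  (forall a b, P (lact a (fd Gam b))) -> forall w, P w.
Proof.
by move=> P0 PD Pd w; have [s ->] := fd_gen w; elim/big_ind: _ => [||p _].
Qed.

Lemma fd1 : fd Gam 1 = 0.
Proof.
have := fd_leibniz Gam 1 1; rewrite mulr1 ract1 lact1 => /eqP.
by rewrite -subr_eq subrr eq_sym => /eqP.
Qed.

Lemma fdX_eq0 a n : fd Gam a = 0 -> fd Gam (a ^+ n) = 0.
Proof.
move=> da; elim: n => [|n IH]; first by rewrite expr0 fd1.
by rewrite exprS fd_leibniz da IH (lin0 (ract_linl _)) (lin0 (lact_linr _)) addr0.
Qed.

Lemma ract_fd a b : ract (fd Gam a) b = fd Gam (a * b) - lact a (fd Gam b).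
Proof. by rewrite fd_leibniz addrK. Qed.
End FodcTheory.

(** * Equivariance of a covariant calculus under U_q(g) *)

Section CovariantCalculus.
Variables (C : fieldType) (g : simple_type) (q : C) (A : algType C).
Local Notation U := (Uq g q).
Variables (j : A -> Uq_dual g q) (tr : U -> A -> A).
Hypotheses (trE : forall X a, ev X (Oq_coact j a) = tr X a)
  (tr_linearl : forall c X Y a, tr (c *: X + Y) a = c *: tr X a + tr Y a)
  (tr1 : forall X, tr X 1 = counit X *: 1)
  (trM : forall X a b,
     tr X (a * b) = \sum_(p <- repr (coprod X)) tr p.1 a * tr p.2 b).
Variables (Gam : fodc A) (delta : Gam -> ftens (Oq g q) Gam).
Hypothesis delta_cov : covariant j delta.

Let delta_linear : linear delta. Proof. by case: delta_cov => [[]]. Qed.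
Let trl_linear a : linear (tr^~ a). Proof. by move=> c X Y; rewrite tr_linearl. Qed.

Lemma ev_cov_linear X : linear (fun w => ev X (delta w)).
Proof. by move=> c u v; rewrite delta_linear ev_linear. Qed.

Lemma ev_lact_fd X a b : ev X (delta (lact a (fd Gam b))) =
  \sum_(p <- repr (coprod X)) lact (tr p.1 a) (fd Gam (tr p.2 b)).
Proof.
case: delta_cov => _ ->.
rewrite (@ev_tlift2 _ _ _ _ _ _ (fun c c' => lact c (fd Gam c'))).
- by apply: eq_bigr => p _; rewrite !trE.
- by move=> n; exact: lact_linl.
- by move=> m; apply: comp_linear; [exact: lact_linr|exact: fd_linear].
Qed.

Lemma ev_fd X a : ev X (delta (fd Gam a)) = fd Gam (tr X a).
Proof.
rewrite -[fd Gam a]lact1 ev_lact_fd.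
have lf : linear (fun Y => fd Gam (tr Y a)).
  by apply: comp_linear; [exact: fd_linear|exact: trl_linear].
(* The left factor 1 contributes the counit of X_(1), which recombines with X_(2) to X. *)
rewrite -{2}[X]counit_coprodl /tlift /fsum (lin_sum _ _ _ lf).
apply: eq_bigr => p _; rewrite tr1 (linZ _ _ (lact_linl _)) lact1.
by rewrite (linZ _ _ lf).
Qed.

(** Covariance prescribes the coaction only on elements b dc. Right multiplication is reduced to
    these by (b dc) a = b d(ca) - bc da, at the price of coassociativity. *)
Lemma ev_ract X w a : ev X (delta (ract w a)) =
  \sum_(p <- repr (coprod X)) ract (ev p.1 (delta w)) (tr p.2 a).
Proof.
elim/fodc_ind: w => [|u v IHu IHv|b c].
- rewrite (lin0 (ract_linl _)) (lin0 (ev_cov_linear X)).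
  by rewrite big1 // => p _; rewrite (lin0 (ev_cov_linear _)) (lin0 (ract_linl _)).
- rewrite (linD (ract_linl _)) (linD (ev_cov_linear X)) IHu IHv -big_split.
  by apply: eq_bigr => p _; rewrite (linD (ev_cov_linear _)) (linD (ract_linl _)).
rewrite lractA ract_fd (linB (lact_linr _)) -lactM (linB (ev_cov_linear X)) !ev_lact_fd.
(* [T] comes from bc da and [T'] from b (dc) a. Both are regrouped so that X_(1) acts on b and the
   two parts of X_(2) act on c and a. *)
pose T Y1 Y2 Y3 := lact (tr Y1 b) (lact (tr Y2 c) (fd Gam (tr Y3 a))).
pose T' Y1 Y2 Y3 := lact (tr Y1 b) (ract (fd Gam (tr Y2 c)) (tr Y3 a)).
have -> : \sum_(p <- repr (coprod X)) lact (tr p.1 (b * c)) (fd Gam (tr p.2 a)) =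
    \sum_(p <- repr (coprod X)) \sum_(r <- repr (coprod p.2)) T p.1 r.1 r.2.
  rewrite -coprod_coassoc; first last.
  - by move=> Y1 Y2 k Y Z; rewrite /T tr_linearl fd_linear !lact_linr.
  - by move=> Y1 Y2 k Y Z; rewrite /T tr_linearl lact_linl !lact_linr.
  - by move=> Y1 Y2 k Y Z; rewrite /T tr_linearl lact_linl.
  apply: eq_bigr => p _; rewrite trM (lin_sum _ _ _ (lact_linl _)).
  by apply: eq_bigr => r _; rewrite lactM.
have -> : \sum_(p <- repr (coprod X))
      ract (ev p.1 (delta (lact b (fd Gam c)))) (tr p.2 a) =
    \sum_(p <- repr (coprod X)) \sum_(r <- repr (coprod p.2)) T' p.1 r.1 r.2.
  rewrite -coprod_coassoc; first last.
  - by move=> Y1 Y2 k Y Z; rewrite /T' tr_linearl ract_linr lact_linr.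
  - by move=> Y1 Y2 k Y Z; rewrite /T' tr_linearl fd_linear ract_linl lact_linr.
  - by move=> Y1 Y2 k Y Z; rewrite /T' tr_linearl lact_linl.
  apply: eq_bigr => p _; rewrite ev_lact_fd (lin_sum _ _ _ (ract_linl _)).
  by apply: eq_bigr => r _; rewrite lractA.
(* For each term of the coproduct of X, only the Leibniz rule for the translates of c and a is
   left. *)
rewrite -sumrB; apply: eq_bigr => p _.
have lf : linear (fun y => lact (tr p.1 b) (fd Gam y)).
  by apply: comp_linear; [exact: lact_linr|exact: fd_linear].
rewrite trM (lin_sum _ _ _ lf) -sumrB; apply: eq_bigr => r _.
by rewrite /T /T' ract_fd (linB (lact_linr _)).
Qed.
End CovariantCalculus.

(** * Translations on O_q(G), O_q(G/L_S^s) and B *)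

Section Translations.
Variables (C : fieldType) (g : simple_type) (q : C) (x : 'I_(rank g)).
Local Notation U := (Uq g q).
Local Notation D := (Uq_dual g q).
Local Notation H := (Oq g q).
Local Notation A := (Oq_phs q x).
Local Notation B := (Oq_flag q x).

Lemma rtrans_Oq X (h : H) : rtrans X (oval h) \in @Oq_pred C g q.
Proof.
have [s sE] := Oq_coprod_ex h.
have -> : rtrans X (oval h) = oval (\sum_(p <- s) oval p.1 X *: p.2).
  apply: dualP => Y; rewrite /= sE /oval raddf_sum dual_sumE.
  by apply: eq_bigr => p _.
exact: valP.
Qed.
Definition oact X (h : H) : H := Sub (rtrans X (oval h)) (rtrans_Oq X h).

(** Left and right multiplications of U_q(g) commute. *)
Lemma rtrans_invariant (L : U -> Prop) X phi :
  invariant_under L phi -> invariant_under L (rtrans X phi).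
Proof.
move=> hphi Y LY; have phiY := hphi _ LY.
by apply: dualP => Z; rewrite /= mulrA -[LHS]/(lact_dual Y phi (X * Z)) phiY.
Qed.

Lemma phs_act_sub X (a : A) : oact X (val a) \in phs_pred x.
Proof. by apply/asboolP/rtrans_invariant/asboolP/(valP a). Qed.
Definition phs_act X (a : A) : A := Sub (oact X (val a)) (phs_act_sub X a).

Lemma flag_act_sub X (b : B) : oact X (val b) \in flag_pred x.
Proof. by apply/asboolP/rtrans_invariant/asboolP/(valP b). Qed.
Definition flag_act X (b : B) : B := Sub (oact X (val b)) (flag_act_sub X b).

Lemma phs_val_inj : injective (@phs_val C g q x).
Proof. by move=> a b /val_inj/val_inj. Qed.
Lemma flag_val_inj : injective (@flag_val C g q x).
Proof. by move=> a b /val_inj/val_inj. Qed.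
Lemma phs_val_linear : linear (@phs_val C g q x). Proof. by []. Qed.
Lemma phs_valM : {morph @phs_val C g q x : a b / a * b}. Proof. by []. Qed.
Lemma phs_val_act X a : phs_val (phs_act X a) = rtrans X (phs_val a). Proof. by []. Qed.

Lemma ev_phs_coact X a : ev X (Oq_coact (@phs_val C g q x) a) = phs_act X a.
Proof.
apply: ev_coact => // [|a']; [exact: phs_val_inj|exact: (valP (val a'))].
Qed.
Lemma ev_flag_coact X b : ev X (Oq_coact (@flag_val C g q x) b) = flag_act X b.
Proof.
apply: ev_coact => // [|b']; [exact: flag_val_inj|exact: (valP (val b'))].
Qed.

Lemma phs_act_linear X : linear (phs_act X).
Proof.
by move=> c a b; apply/phs_val_inj; rewrite !(phs_val_linear, phs_val_act) rtrans_linear.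
Qed.
Lemma phs_act_linearl c X Y a : phs_act (c *: X + Y) a = c *: phs_act X a + phs_act Y a.
Proof. by apply/phs_val_inj; rewrite !(phs_val_linear, phs_val_act) rtrans_linearl. Qed.
Lemma phs_act1 X : phs_act X 1 = counit X *: 1.
Proof. by apply/phs_val_inj; exact: rtrans1. Qed.
Lemma phs_actM X a b :
  phs_act X (a * b) = \sum_(p <- repr (coprod X)) phs_act p.1 a * phs_act p.2 b.
Proof.
apply/phs_val_inj; rewrite (lin_sum _ _ _ phs_val_linear) phs_val_act phs_valM rtransM.
by apply: eq_bigr => p _; rewrite phs_valM.
Qed.

Lemma flag_incl_act X b : flag_incl (flag_act X b) = phs_act X (flag_incl b).
Proof. exact: phs_val_inj. Qed.

Lemma flag_incl_inj : injective (@flag_incl C g q x).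
Proof. by move=> a b /(congr1 val) ab; apply: val_inj. Qed.

Lemma to_flagK (a : A) : val a \in flag_pred x -> flag_incl (to_flag a) = a.
Proof. by move=> ha; apply/val_inj; rewrite -[LHS]/(val (insubd 0 (val a))) insubdK. Qed.

(** [to_flag] sends everything outside B to 0, so its linearity has to be argued along maps with
    values in B. *)
Lemma to_flag_linear (M : lmodType C) (F : M -> A) : linear F ->
  (forall m, flag_incl (to_flag (F m)) = F m) -> linear (fun m => to_flag (F m) : B).
Proof.
move=> F_linear FB c m m'; apply: flag_incl_inj.
have incl_lin := flag_incl_lin c (to_flag (F m)) (to_flag (F m')).
by rewrite FB [RHS]incl_lin !FB F_linear.
Qed.

(** * V_k lies in the kernel of d *)

Section Holomorphic.
Variables (Gam : fodc A) (dGam : Gam -> ftens H Gam).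
Hypothesis dGam_cov : covariant (@phs_val C g q x) dGam.

Lemma hol_module_closed N (z : 'I_N.+1 -> A) k a :
  fd Gam (z ord_max) = 0 -> hol_module z k a -> fd Gam a = 0.
Proof.
(* V_k is contained in every subcomodule through the power of the highest weight generator; here
   that subcomodule is the kernel of d. *)
move=> dz /(_ (fun b => fd Gam b = 0)); apply; last exact: fdX_eq0.
apply: (coact_subcomodule (act := phs_act)) => //.
- exact: phs_val_inj.
- by move=> a'; exact: (valP (val a')).
- split; first exact: lin0 (fd_linear Gam).
  by move=> c m n m0 n0; rewrite fd_linear m0 n0 scaler0 addr0.
move=> X m m0.
(* d intertwines the translations, so d of a translate of m is a translate of dm = 0. *)
rewrite -(ev_fd ev_phs_coact phs_act_linearl phs_act1 dGam_cov) m0.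
by rewrite (lin0 (ev_cov_linear dGam_cov X)).
Qed.
End Holomorphic.

(** * Relative line modules: translations and weights *)

Section RelLines.
Variables (N : nat) (rho rho' : U -> 'M[C]_N.+1) (z zb : 'I_N.+1 -> A).
Hypotheses (rhoP : is_rep rho) (rho'P : is_rep rho')
  (zP : forall i X, phs_val (z i) X = rho X i ord_max)
  (zbP : forall i X, phs_val (zb i) X = rho' X i ord_max).

Lemma line_lincomb k (J : Type) (s : seq J) (F : J -> A) (c : J -> C) :
  (forall i, line z zb k (F i)) -> line z zb k (\sum_(i <- s) c i *: F i).
Proof.
move=> hF; elim: s => [|i s IH]; first by rewrite big_nil; exact: line_0.
by rewrite big_cons; exact: line_lin.
Qed.

Lemma phs_act_coef (sg : U -> 'M[C]_N.+1) (w : 'I_N.+1 -> A) i X : is_rep sg ->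
  (forall i X, phs_val (w i) X = sg X i ord_max) ->
  phs_act X (w i) = \sum_k sg X i k *: w k.
Proof.
move=> sgP wP; apply/phs_val_inj/dualP => Y.
rewrite phs_val_act /= wP (repM sgP) mxE (lin_sum _ _ _ phs_val_linear) dual_sumE.
by apply: eq_bigr => k _; rewrite -wP.
Qed.

(** Translations preserve the degree because they preserve B and the spans of the z_i and of the
    zb_j; hence U_q(g) acts on each E_k. *)
Lemma line_phs_act k a X : line z zb k a -> line z zb k (phs_act X a).
Proof.
move=> ha; elim: ha X => {k a} [b|i|i|k|k c a b _ IHa _ IHb|k l a b _ IHa _ IHb] X.
- by rewrite -flag_incl_act; exact: line_flag.
- by rewrite (phs_act_coef i X rhoP zP); apply: line_lincomb => j; exact: line_z.
- by rewrite (phs_act_coef i X rho'P zbP); apply: line_lincomb => j; exact: line_zb.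
- by rewrite (lin0 (phs_act_linear X)); exact: line_0.
- by rewrite phs_act_linear; exact: line_lin.
- rewrite phs_actM; under eq_bigr => p _ do rewrite -[_ * _]scale1r.
  by apply: line_lincomb => p; exact: line_mul.
Qed.

Section OneLine.
Variable k : int.
Local Notation E := (line_bimod z zb k).

Lemma line_act_sub X (e : E) : phs_act X (line_elt e) \in line_pred z zb k.
Proof. by apply/asboolP/line_phs_act/asboolP/(valP (e : rel_line z zb k)). Qed.
Definition line_act X (e : E) : E :=
  (Sub (phs_act X (line_elt e)) (line_act_sub X e) : rel_line z zb k).

Lemma line_elt_act X e : line_elt (line_act X e) = phs_act X (line_elt e).
Proof. by []. Qed.
Lemma line_elt_inj : injective (@line_elt C g q x N z zb k).
Proof. by move=> a b /val_inj. Qed.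
Lemma line_elt_linear : linear (@line_elt C g q x N z zb k).
Proof. by []. Qed.
Lemma line_elt_lact b (e : E) : line_elt (lact b e) = flag_incl b * line_elt e.
Proof. by []. Qed.
Lemma line_elt_ract (e : E) b : line_elt (ract e b) = line_elt e * flag_incl b.
Proof. by []. Qed.

Lemma ev_line_coact X e : ev X (@line_coact C g q x N z zb k e) = line_act X e.
Proof.
apply: ev_coact => // [a b|a]; last exact: (valP (val (line_elt a))).
by move/phs_val_inj/line_elt_inj.
Qed.
End OneLine.

(** K_x is grouplike, so it acts by an algebra map and its eigenvalue records the degree. *)
Lemma line_weight k a :
  (forall i, lact_dual (gK q x) (phs_val (z i)) = qi q x *: phs_val (z i)) ->
  (forall i, lact_dual (gK q x) (phs_val (zb i)) = (qi q x)^-1 *: phs_val (zb i)) ->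
  q != 0 -> line z zb k a ->
  lact_dual (gK q x) (phs_val a) = (qi q x ^ k) *: phs_val a.
Proof.
move=> zK zbK q0; elim=> {k a} [b|i|i|k|k c a b _ IHa _ IHb|k l a b _ IHa _ IHb].
- have /asboolP -> // := valP b; last by apply: ag_gen; left; exists x; left.
  by rewrite counitK expr0z.
- by rewrite zK expr1z.
- by rewrite zbK.
- by rewrite (lin0 phs_val_linear) scaler0; exact: dualP.
- by rewrite phs_val_linear lact_dual_lin IHa IHb scalerDr !scalerA mulrC.
- rewrite phs_valM lactK IHa IHb.
  by rewrite -scalerAl -scalerAr scalerA expfzDr ?expf_neq0.
Qed.

End RelLines.
End Translations.

(** * Elements of degree zero lie in B *)

Section Weights.
Variables (C : fieldType) (g : simple_type) (q : C) (x : 'I_(rank g)).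
Local Notation U := (Uq g q).

Lemma antipodeK (S : U -> U) i : antipode S -> S (gK q i) = gKinv q i.
Proof.
case=> S_lin /(_ (gK q i)) [+ _]; rewrite coprodK counitK scale1r.
rewrite tlift_tensor => [SK|]; last first.
  apply: fbalanced => [n c a b|n c a b]; first by rewrite S_lin mulrDl -scalerAl.
  by rewrite mulrDr -scalerAr.
by rewrite -[LHS]mulr1 -(rel_KV (gen_rels g q) i) mulrA SK mul1r.
Qed.

Variables (N : nat) (rho rho' : U -> 'M[C]_N.+1) (z zb : 'I_N.+1 -> Oq_phs q x).
Hypotheses (q_neq0 : q != 0) (rhoP : irr_module (fund_weight x) rho)
  (rho'P : dual_module rho rho')
  (zP : forall i X, phs_val (z i) X = rho X i ord_max)
  (zbP : forall i X, phs_val (zb i) X = rho' X i ord_max).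

Lemma weight_vector_Kinv mu v i :
  weight_vector rho mu v -> rho (gKinv q i) *m v = (qi q i ^ mu i)^-1 *: v.
Proof.
move=> /(_ i) vK; have c0 : qi q i ^ mu i != 0 by rewrite expfz_neq0 // expf_neq0.
apply: (can_inj (scalerK c0)); rewrite scalerA divff // scale1r scalemxAr -vK mulmxA.
rewrite -(repM (irr_rep rhoP)) (rel_VK (gen_rels g q)) (rep1 (irr_rep rhoP)).
by rewrite mul1mx.
Qed.

(** u_N has weight varpi_x, on which K_x acts by q_x. *)
Lemma phs_weight_z i :
  lact_dual (gK q x) (phs_val (z i)) = qi q x *: phs_val (z i).
Proof.
apply: dualP => X; rewrite -[RHS]/(qi q x * phs_val (z i) X) /= !zP.
rewrite (repM (irr_rep rhoP)).
have := irr_hwK rhoP x; rewrite /fund_weight eqxx expr1z => hw.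
have colE' (P : 'M[C]_N.+1) : P i ord_max = (P *m delta_mx ord_max 0) i (0 : 'I_1).
  by rewrite -colE mxE.
by rewrite colE' -mulmxA hw -scalemxAr mxE -colE'.
Qed.

(** The dual vector u^N has weight -varpi_x, since the antipode inverts K_x. *)
Lemma phs_weight_zb i :
  lact_dual (gK q x) (phs_val (zb i)) = (qi q x)^-1 *: phs_val (zb i).
Proof.
have [rho'R [S SP rho'E]] := rho'P.
apply: dualP => X; rewrite -[RHS]/((qi q x)^-1 * phs_val (zb i) X) /= !zbP.
rewrite (repM rho'R) mxE (bigD1 ord_max) //=.
(* The entry is the u_N-coordinate of K_x^(-1) u_j; it vanishes for j other than N because u_j is a
   weight vector. *)
have KE j mu : weight_vector rho mu (delta_mx j 0) ->
    rho' (gK q x) j ord_max = (qi q x ^ mu x)^-1 * (ord_max == j)%:R.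
  rewrite rho'E antipodeK // mxE.
  move=> /(@weight_vector_Kinv _ _ x)/matrixP/(_ ord_max 0).
  by rewrite -colE !mxE andbT.
rewrite (KE _ _ (irr_hwK rhoP)) /fund_weight !eqxx expr1z mulr1 mulrC big1 ?addr0 //.
move=> j jN; have [mu muP] := irr_basis rhoP j.
by rewrite (KE _ _ muP) eq_sym (negPf jN) !mulr0.
Qed.

(** Degree zero means invariance under K_x, by [line_weight]. With invariance under U_q(l_S^s),
    which holds in the whole algebra, this covers all generators of U_q(l_S). *)
Lemma line0_flag a : line z zb 0 a -> val a \in flag_pred x.
Proof.
move=> /(line_weight phs_weight_z phs_weight_zb q_neq0); rewrite expr0z scale1r => aK.
apply/asboolP/invariant_gen => X.
have /asboolP aL := valP a.
have levisL Y : levis_gen x Y -> lact_dual Y (val (val a)) = counit Y *: val (val a).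
  by move=> hY; apply: aL; exact: ag_gen.
case=> [[i [->|->]]|[s sx [->|->]]].
- have [->|ix] := eqVneq i x; first by rewrite counitK scale1r.
  by apply: levisL; exists i => //; exact: Or41.
- have [->|ix] := eqVneq i x; last by apply: levisL; exists i => //; exact: Or42.
  (* K_x^(-1) is applied to a written as K_x a. *)
  rewrite counitKinv scale1r -[val (val a)]/(phs_val a) -[in LHS]aK -lact_dual_mul
    (rel_VK (gen_rels g q)).
  exact: lact_dual1.
- by apply: levisL; exists s => //; exact: Or43.
- by apply: levisL; exists s => //; exact: Or44.
Qed.

(** Products of opposite degrees lie in B, so [to_flag] does not fall back on its default 0. *)
Lemma line_mul_flag k l (e : line_bimod z zb k) (e' : line_bimod z zb l) : k + l = 0 ->
  flag_incl (to_flag (line_elt e * line_elt e')) = line_elt e * line_elt e'.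
Proof.
move=> kl; apply/to_flagK/line0_flag; rewrite -kl.
by apply: line_mul; [exact/asboolP/(valP (e : rel_line z zb k))|
  exact/asboolP/(valP (e' : rel_line z zb l))].
Qed.
End Weights.

(** * Multiplication from Om (x)_B E_k to Gam *)

Section Pairing.
Variables (C : fieldType) (g : simple_type) (q : C) (x : 'I_(rank g)).
Local Notation U := (Uq g q).
Local Notation A := (Oq_phs q x).
Local Notation B := (Oq_flag q x).
Local Notation H := (Oq g q).
Variables (N : nat) (rho rho' : U -> 'M[C]_N.+1) (z zb : 'I_N.+1 -> A).
Hypotheses (rhoP : is_rep rho) (rho'P : is_rep rho')
  (zP : forall i X, phs_val (z i) X = rho X i ord_max)
  (zbP : forall i X, phs_val (zb i) X = rho' X i ord_max).
Variables (Gam : fodc A) (dGam : Gam -> ftens H Gam) (Om : fodc B)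
  (dOm : Om -> ftens H Om) (iota : Om -> Gam).
Hypotheses (dGam_cov : covariant (@phs_val C g q x) dGam)
  (dOm_cov : covariant (@flag_val C g q x) dOm).
Hypotheses (iota_linear : linear iota) (iota_inj : injective iota)
  (iotal : forall b w, iota (lact b w) = lact (flag_incl b) (iota w))
  (iotar : forall w b, iota (ract w b) = ract (iota w) (flag_incl b))
  (iotad : forall b, iota (fd Om b) = fd Gam (flag_incl b)).

Let ev_flag_fd := ev_lact_fd (@ev_flag_coact C g q x) dOm_cov.
Let ev_phs_fd := ev_lact_fd (@ev_phs_coact C g q x) dGam_cov.
Let ev_phs_ract := ev_ract (@ev_phs_coact C g q x) (@phs_act_linearl C g q x)
  (@phs_actM C g q x) dGam_cov.
Let ev_phs_d := ev_fd (@ev_phs_coact C g q x) (@phs_act_linearl C g q x)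
  (@phs_act1 C g q x) dGam_cov.

(** Equivariance of [iota] is automatic: covariance determines both coactions on the elements b dc,
    and [iota] preserves these. *)
Lemma iota_ev X w : iota (ev X (dOm w)) = ev X (dGam (iota w)).
Proof.
elim/fodc_ind: w => [|u v IHu IHv|b c].
- rewrite (lin0 (ev_cov_linear dOm_cov X)) (lin0 iota_linear).
  by rewrite (lin0 (ev_cov_linear dGam_cov X)).
- rewrite (linD (ev_cov_linear dOm_cov X)) !(linD iota_linear).
  by rewrite (linD (ev_cov_linear dGam_cov X)) IHu IHv.
rewrite iotal iotad ev_phs_fd ev_flag_fd (lin_sum _ _ _ iota_linear).
by apply: eq_bigr => p _; rewrite iotal iotad !flag_incl_act.
Qed.

Variable k : int.
Local Notation E := (line_bimod z zb k).

(* Locked: conversion would otherwise unfold the quotient defining tensors. *)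
Definition fodc_pair : btens Om E -> Gam :=
  locked (tlift (fun w (e : E) => ract (iota w) (line_elt e))).

Lemma fodc_pair_bal : balanced (@ract _ _ Om) (@lact _ _ E)
  (fun w e => ract (iota w) (line_elt e)).
Proof.
split=> [n c u v|w c u v|w b e].
- by rewrite iota_linear ract_linl.
- by rewrite line_elt_linear ract_linr.
- by rewrite iotar -ractM.
Qed.

Lemma fodc_pair_linear : linear fodc_pair.
Proof. by rewrite /fodc_pair -lock; exact: tlift_linear fodc_pair_bal. Qed.
Lemma fodc_pair_ten w e : fodc_pair (bten Om E w e) = ract (iota w) (line_elt e).
Proof. by rewrite /fodc_pair -lock; exact: tlift_tensor fodc_pair_bal. Qed.

Lemma fodc_pair_lact b t : fodc_pair (btens_lact b t) = lact (flag_incl b) (fodc_pair t).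
Proof.
move: t; apply: btens_ext => [||w e].
- by apply: comp_linear; [exact: fodc_pair_linear|exact: btens_lact_linr].
- by apply: comp_linear; [exact: lact_linr|exact: fodc_pair_linear].
- by rewrite btens_lact_ten !fodc_pair_ten iotal lractA.
Qed.

Lemma fodc_pair_ract t b : fodc_pair (btens_ract t b) = ract (fodc_pair t) (flag_incl b).
Proof.
move: t; apply: btens_ext => [||w e].
- by apply: comp_linear; [exact: fodc_pair_linear|exact: btens_ract_linl].
- by apply: (comp_linear (ract_linl _)); exact: fodc_pair_linear.
- by rewrite btens_ract_ten !fodc_pair_ten line_elt_ract ractM.
Qed.

(** On w (x) e this is [ev_ract] in Gam combined with [iota_ev]; it makes the pairing
    equivariant. *)
Lemma fodc_pair_coact X t :
  fodc_pair (ev X (tens_coact dOm (@line_coact C g q x N z zb k) t)) =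
  ev X (dGam (fodc_pair t)).
Proof.
have lG := ev_cov_linear dGam_cov X.
have -> : fodc_pair t = \sum_(p <- repr t) ract (iota p.1) (line_elt p.2).
  by rewrite /fodc_pair -lock.
rewrite (lin_sum _ _ _ lG) /tens_coact {1}/tlift /fsum.
rewrite (lin_sum _ _ _ (@ev_linear C g q (btens Om E) X)).
rewrite (lin_sum _ _ _ fodc_pair_linear); apply: eq_bigr => p _.
have [T1 T2 _] := tensor_balanced (@ract _ _ Om) (@lact _ _ E).
rewrite (ev_tlift2 _ _ _ T1 T2) (lin_sum _ _ _ fodc_pair_linear) ev_phs_ract.
apply: eq_bigr => r _; rewrite fodc_pair_ten iota_ev.
by rewrite (ev_line_coact rhoP rho'P zP zbP) line_elt_act.
Qed.

(** * The connection given by a frame sum_i p_i r_i = 1, and its bimodule map *)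

Section Frame.
Variables (M : nat) (p : 'I_M -> A) (r : 'I_M -> E).
Hypotheses (pr1 : \sum_i p i * line_elt (r i) = 1)
  (prB : forall (e : E) i, flag_incl (to_flag (line_elt e * p i)) = line_elt e * p i).

(* w (x) e = sum_i w (e p_i) (x) r_i with e p_i in B, so w e determines w (x) e. *)
Lemma fodc_pair_inj : injective fodc_pair.
Proof.
have toB_linear i : linear (fun e : E => to_flag (line_elt e * p i) : B).
  by apply: to_flag_linear => // c e e'; rewrite line_elt_linear mulrDl -scalerAl.
pose s i (t : btens Om E) : Om :=
  tlift (fun w (e : E) => ract w (to_flag (line_elt e * p i))) t.
have s_bal i : balanced (@ract _ _ Om) (@lact _ _ E)
    (fun w (e : E) => ract w (to_flag (line_elt e * p i))).
  split=> [n c u v|w c u v|w b e]; first exact: ract_linl.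
    by rewrite toB_linear ract_linr.
  rewrite -ractM; congr ract; apply: flag_incl_inj.
  by rewrite (prB (lact b e) i) (flag_inclM b (to_flag _)) (prB e i) line_elt_lact mulrA.
have s_linear i : linear (s i) := tlift_linear (s_bal i).
have sE i t : iota (s i t) = ract (fodc_pair t) (p i).
  move: t; apply: btens_ext => [||w e].
  - by apply: comp_linear => //; exact: s_linear.
  - by apply: (comp_linear (ract_linl _)); exact: fodc_pair_linear.
  - by rewrite /s tlift_tensor // iotar prB fodc_pair_ten ractM.
have tE t : t = \sum_i bten Om E (s i t) (r i).
  have [T1 T2 T3] := tensor_balanced (@ract _ _ Om) (@lact _ _ E).
  move: t; apply: btens_ext => // [c u v|w e].
    rewrite scaler_sumr -big_split; apply: eq_bigr => i _ /=.
    by rewrite s_linear T1.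
  under eq_bigr => i _ do rewrite /s tlift_tensor // T3.
  rewrite -(lin_sum _ _ _ (T2 w)); congr tensor; apply: line_elt_inj.
  rewrite (lin_sum _ _ _ (@line_elt_linear _ _ _ _ _ _ _ k)).
  under eq_bigr => i _ do rewrite line_elt_lact prB -mulrA.
  by rewrite -mulr_sumr pr1 mulr1.
move=> t u tu; rewrite [t]tE [u]tE; apply: eq_bigr => i _; congr tensor.
by apply: iota_inj; rewrite !sE tu.
Qed.

Hypothesis pr_d : forall e : E,
  \sum_i ract (fd Gam (line_elt e * p i)) (line_elt (r i)) = fd Gam (line_elt e).

(** Under [pr_d] this is the preimage of de under the embedding [fodc_pair]. It is locked so that
    tensors stay folded during conversion. *)
Definition pair_conn : E -> btens_bimod Om E :=
  locked (fun e => \sum_i bten Om E (fd Om (to_flag (line_elt e * p i))) (r i)).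

Lemma fodc_pair_conn e : fodc_pair (pair_conn e) = fd Gam (line_elt e).
Proof.
rewrite /pair_conn -lock (lin_sum _ _ _ fodc_pair_linear) -pr_d; apply: eq_bigr => i _.
by rewrite fodc_pair_ten iotad prB.
Qed.

(** Each identity is tested after the injective equivariant map [fodc_pair], which turns [pair_conn]
    into d; there it is linearity, the Leibniz rule or equivariance of d. *)
Lemma pair_conn_covariant :
  covariant_connection dOm (@line_coact C g q x N z zb k) pair_conn.
Proof.
have conn_linear : linear pair_conn.
  move=> c e e'; apply: fodc_pair_inj; rewrite fodc_pair_linear !fodc_pair_conn.
  by rewrite line_elt_linear fd_linear.
split; first split=> // b e.
  apply: fodc_pair_inj; rewrite (linD fodc_pair_linear) fodc_pair_lact fodc_pair_ten.
  by rewrite !fodc_pair_conn line_elt_lact fd_leibniz iotad.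
move=> e; apply: ev_ext => X; apply: fodc_pair_inj.
rewrite fodc_pair_coact fodc_pair_conn ev_phs_d.
rewrite -(line_elt_act rhoP rho'P zP zbP) -fodc_pair_conn.
(* What remains is that the linear map [pair_conn] commutes with evaluation at X. *)
congr fodc_pair; rewrite -ev_line_coact.
set t := line_coact e.
have -> : ev X t = \sum_(a <- repr t) oval a.1 X *: a.2 by [].
rewrite (lin_sum _ _ _ conn_linear) {1}/tlift /fsum.
rewrite (lin_sum _ _ _ (@ev_linear C g q (btens Om E) X)).
by apply: eq_bigr => a _; rewrite ev_ten (linZ _ _ conn_linear).
Qed.

Variables (nabla : E -> btens_bimod Om E)
  (sigma : btens_bimod E Om -> btens_bimod Om E)
  (sigmaV : btens_bimod Om E -> btens_bimod E Om).
Hypothesis nablaP : dbar_connection dOm nabla sigma sigmaV.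

Lemma nablaE e : nabla e = pair_conn e.
Proof. by rewrite (dbar_unique nablaP pair_conn_covariant). Qed.

Lemma sigma_fd e b : sigma (bten E Om e (fd Om b)) =
  \sum_i bten Om E (fd Om (to_flag (line_elt e * flag_incl b * p i))) (r i)
  - \sum_i bten Om E (fd Om (to_flag (line_elt e * p i))) (ract (r i) b).
Proof.
have [_ ->] := dbar_sigma nablaP; rewrite !nablaE /pair_conn -lock; congr (_ - _).
rewrite -[LHS]/(btens_ract _ _) (lin_sum _ _ _ (btens_ract_linl b)).
by apply: eq_bigr => i _; rewrite btens_ract_ten.
Qed.

(** In Gam the defining formula of [sigma] reads d(eb) - (de) b = e db. *)
Lemma fodc_pair_sigma e b : fodc_pair (sigma (bten E Om e (fd Om b))) =
  lact (line_elt e) (fd Gam (flag_incl b)).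
Proof.
have [_ ->] := dbar_sigma nablaP; rewrite !nablaE (linB fodc_pair_linear).
rewrite fodc_pair_ract !fodc_pair_conn line_elt_ract ract_fd.
by rewrite opprB addrC subrK.
Qed.

(** [sigma] and [fodc_pair] are injective, so the formula is checked after applying both. A second
    frame (r', p'), with the coefficients on the left, is used to expand d. *)
Lemma sigmaV_fd M' (r' : 'I_M' -> E) (p' : 'I_M' -> A) :
  (forall i (e : E), flag_incl (to_flag (p' i * line_elt e)) = p' i * line_elt e) ->
  (forall e : E,
    \sum_i lact (line_elt (r' i)) (fd Gam (p' i * line_elt e)) = fd Gam (line_elt e)) ->
  forall b e, sigmaV (bten Om E (fd Om b) e) =
    \sum_i bten E Om (r' i) (fd Om (to_flag (p' i * flag_incl b * line_elt e)))
    - \sum_i bten E Om (lact b (r' i)) (fd Om (to_flag (p' i * line_elt e))).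
Proof.
move=> p'B p'_d b e; have [[sig_linear _ _] _] := dbar_sigma nablaP.
apply: (can_inj (dbar_sigmaK nablaP)); rewrite (dbar_sigmaVK nablaP).
apply: fodc_pair_inj; rewrite (linB sig_linear) (linB fodc_pair_linear) fodc_pair_ten.
(* This is (db) e = d(be) - b de with both differentials on the right expanded in the second
   frame. *)
have -> : ract (iota (fd Om b)) (line_elt e) =
    \sum_i lact (line_elt (r' i)) (fd Gam (p' i * line_elt (lact b e)))
    - \sum_i lact (flag_incl b) (lact (line_elt (r' i)) (fd Gam (p' i * line_elt e))).
  rewrite (p'_d (lact b e)) -(lin_sum _ _ _ (lact_linr _)) (p'_d e) line_elt_lact iotad.
  exact: ract_fd.
congr (_ - _); rewrite (lin_sum _ _ _ sig_linear) (lin_sum _ _ _ fodc_pair_linear);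
  apply: eq_bigr => i _; rewrite fodc_pair_sigma.
  by rewrite -mulrA -line_elt_lact p'B.
by rewrite line_elt_lact lactM p'B.
Qed.
End Frame.
End Pairing.

(** * The four formulas, from the two decompositions of 1 *)

Theorem proposition4p1 (R : realType) (g : simple_type) (q : R)
  (q_neqN1 : q != -1) (q_neq0 : q != 0) (q_neq1 : q != 1)
  (x : 'I_(rank g)) (x_cominuscule : cominuscule x)
  (N : nat) (rho rho' : Uq g q%:C -> 'M[R[i]]_N.+1)
  (rhoP : irr_module (fund_weight x) rho) (rho'P : dual_module rho rho')
  (z zb : 'I_N.+1 -> Oq_phs q%:C x)
  (zP : forall i X, phs_val (z i) X = rho X i ord_max)
  (zbP : forall i X, phs_val (zb i) X = rho' X i ord_max)
  (Gam : fodc (Oq_phs q%:C x)) (Om : fodc (Oq_flag q%:C x))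
  (dOm : Om -> ftens (Oq g q%:C) Om) (OmP : HK_calculus z zb Gam dOm)
  (k : nat) (k_gt0 : (0 < k)%N)
  (nabla : line_bimod z zb k%:Z -> btens_bimod Om (line_bimod z zb k%:Z))
  (sigma : btens_bimod (line_bimod z zb k%:Z) Om ->
           btens_bimod Om (line_bimod z zb k%:Z))
  (sigmaV : btens_bimod Om (line_bimod z zb k%:Z) ->
            btens_bimod (line_bimod z zb k%:Z) Om)
  (nablaP : dbar_connection dOm nabla sigma sigmaV)
  (nablaN : line_bimod z zb (- k%:Z) -> btens_bimod Om (line_bimod z zb (- k%:Z)))
  (sigmaN : btens_bimod (line_bimod z zb (- k%:Z)) Om ->
            btens_bimod Om (line_bimod z zb (- k%:Z)))
  (sigmaNV : btens_bimod Om (line_bimod z zb (- k%:Z)) ->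
             btens_bimod (line_bimod z zb (- k%:Z)) Om)
  (nablaNP : dbar_connection dOm nablaN sigmaN sigmaNV)
  (M : nat) (f f' : 'I_M -> line_bimod z zb k%:Z)
  (v v' : 'I_M -> line_bimod z zb (- k%:Z))
  (fP : forall i, hol_module z k (line_elt (f i)))
  (f'P : forall i, hol_module z k (line_elt (f' i)))
  (vP : forall i, antihol_module zb k (line_elt (v i)))
  (v'P : forall i, antihol_module zb k (line_elt (v' i)))
  (fv : \sum_i line_elt (f i) * line_elt (v i) = 1)
  (v'f' : \sum_i line_elt (v' i) * line_elt (f' i) = 1) :
  ((forall (e : line_bimod z zb k%:Z) (b : Oq_flag q%:C x),
      sigma (bten _ _ e (fd Om b)) =
        \sum_i bten _ _ (fd Om (to_flag (line_elt e * flag_incl b * line_elt (v' i)))) (f' i)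
      - \sum_i bten _ _ (fd Om (to_flag (line_elt e * line_elt (v' i)))) (ract (f' i) b))
   /\
   (forall (b : Oq_flag q%:C x) (e : line_bimod z zb k%:Z),
      sigmaV (bten _ _ (fd Om b) e) =
        \sum_i bten _ _ (f i) (fd Om (to_flag (line_elt (v i) * flag_incl b * line_elt e)))
      - \sum_i bten _ _ (lact b (f i)) (fd Om (to_flag (line_elt (v i) * line_elt e)))))
  /\
  ((forall (e : line_bimod z zb (- k%:Z)) (b : Oq_flag q%:C x),
      sigmaN (bten _ _ e (fd Om b)) =
        \sum_i bten _ _ (fd Om (to_flag (line_elt e * flag_incl b * line_elt (f i)))) (v i)
      - \sum_i bten _ _ (fd Om (to_flag (line_elt e * line_elt (f i)))) (ract (v i) b))
   /\
   (forall (b : Oq_flag q%:C x) (e : line_bimod z zb (- k%:Z)),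
      sigmaNV (bten _ _ (fd Om b) e) =
        \sum_i bten _ _ (v' i) (fd Om (to_flag (line_elt (f' i) * flag_incl b * line_elt e)))
      - \sum_i bten _ _ (lact b (v' i)) (fd Om (to_flag (line_elt (f' i) * line_elt e))))).
Proof.
have q0 : q%:C != 0 by rewrite fmorph_eq0.
have [dGam dGam_cov] := HK_left OmP.
have [iota [iota_lin iota_inj iotal iotar iotad]] := HK_restriction OmP.
have dOm_cov := HK_covariant OmP.
have rhoR := irr_rep rhoP.
have rho'R : is_rep rho' by case: rho'P.
have hol (w : line_bimod z zb k%:Z) :
    hol_module z k (line_elt w) -> fd Gam (line_elt w) = 0.
  by apply: (hol_module_closed dGam_cov); exact: HK_holomorphic OmP _.
have flagM l l' (e : line_bimod z zb l) (e' : line_bimod z zb l') : l + l' = 0 ->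
    flag_incl (to_flag (line_elt e * line_elt e')) = line_elt e * line_elt e'.
  exact: (line_mul_flag q0 rhoP rho'P zP zbP).
have ract_hol a (w : line_bimod z zb k%:Z) : fd Gam (line_elt w) = 0 ->
    ract (fd Gam a) (line_elt w) = fd Gam (a * line_elt w).
  by move=> dw; rewrite ract_fd dw (lin0 (lact_linr _)) subr0.
have lact_hol a (w : line_bimod z zb k%:Z) : fd Gam (line_elt w) = 0 ->
    lact (line_elt w) (fd Gam a) = fd Gam (line_elt w * a).
  by move=> dw; rewrite fd_leibniz dw (lin0 (ract_linl _)) add0r.
have kN : k%:Z - k%:Z = 0 by rewrite subrr.
have Nk : - k%:Z + k%:Z = 0 by rewrite addNr.
(* Since d f'_i = 0, right multiplication by f'_i moves inside d, where v'_i f'_i sums to 1. *)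
have dP (e : line_bimod z zb k%:Z) :
    \sum_i ract (fd Gam (line_elt e * line_elt (v' i))) (line_elt (f' i)) = fd Gam (line_elt e).
  under eq_bigr => i _ do rewrite ract_hol ?hol // -mulrA.
  by rewrite -(lin_sum _ _ _ (@fd_linear _ _ Gam)) -mulr_sumr v'f' mulr1.
(* Here the holomorphic factor f_i moves out of d instead and meets v_i outside. *)
have dN (e : line_bimod z zb (- k%:Z)) :
    \sum_i ract (fd Gam (line_elt e * line_elt (f i))) (line_elt (v i)) = fd Gam (line_elt e).
  transitivity (\sum_i ract (fd Gam (line_elt e)) (line_elt (f i) * line_elt (v i))).
    by apply: eq_bigr => i _; rewrite -ract_hol ?hol // ractM.
  by rewrite -(lin_sum _ _ _ (ract_linr _)) fv ract1.
(* Mirror image of [dP]: f_i enters d from the left. *)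
have dPV (e : line_bimod z zb k%:Z) :
    \sum_i lact (line_elt (f i)) (fd Gam (line_elt (v i) * line_elt e)) = fd Gam (line_elt e).
  under eq_bigr => i _ do rewrite lact_hol ?hol // mulrA.
  by rewrite -(lin_sum _ _ _ (@fd_linear _ _ Gam)) -mulr_suml fv mul1r.
(* Mirror image of [dN]: f'_i leaves d to the left and meets v'_i. *)
have dNV (e : line_bimod z zb (- k%:Z)) :
    \sum_i lact (line_elt (v' i)) (fd Gam (line_elt (f' i) * line_elt e)) = fd Gam (line_elt e).
  transitivity (\sum_i lact (line_elt (v' i) * line_elt (f' i)) (fd Gam (line_elt e))).
    by apply: eq_bigr => i _; rewrite -lact_hol ?hol // lactM.
  by rewrite -(lin_sum _ _ _ (lact_linl _)) v'f' lact1.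
(* The frame (p, r) is (v', f') on E_k and (f, v) on E_{-k}. For the inverses, the second frame (r',
   p') is (f, v) on E_k and (v', f') on E_{-k}. *)
split; split.
- exact: (sigma_fd rhoR rho'R zP zbP dGam_cov dOm_cov iota_lin iota_inj
    iotal iotar iotad v'f' (fun e i => flagM _ _ e (v' i) kN) dP nablaP).
- exact: (sigmaV_fd rhoR rho'R zP zbP dGam_cov dOm_cov iota_lin iota_inj
    iotal iotar iotad v'f' (fun e i => flagM _ _ e (v' i) kN) dP nablaP
    (fun i e => flagM _ _ (v i) e Nk) dPV).
- exact: (sigma_fd rhoR rho'R zP zbP dGam_cov dOm_cov iota_lin iota_inj
    iotal iotar iotad fv (fun e i => flagM _ _ e (f i) Nk) dN nablaNP).
- exact: (sigmaV_fd rhoR rho'R zP zbP dGam_cov dOm_cov iota_lin iota_inj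
    iotal iotar iotad fv (fun e i => flagM _ _ e (f i) Nk) dN nablaNP
    (fun i e => flagM _ _ (f' i) e kN) dNV).
Qed.
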